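(* Suppose that $p$ is hyperbolic with respect to $e\in\mathbb{R}^n$ and $\mathcal{F}$ is a face of $\Lambda_+(p,e)$. Let $z$ be a point of the relative interior of $\mathcal{F}$, let $m=\operatorname{mult}_p(z)$, and let $q(x)=D_e^{m-1}p(x)$. Then $$\operatorname{span}(\mathcal{F})=\{x\in T_z\Lambda_+(q,e) : \left.H_q(z)\right|_{T_z}x=0\}.$$
   Context: A homogeneous polynomial $p$ of degree $d$ in $n$ real variables is hyperbolic with respect to $e\in\mathbb{R}^n$ if $p(e)>0$ and, for each $x\in\mathbb{R}^n$, the univariate polynomial $t\mapsto p(te-x)$ has only real zeros. Its (closed) hyperbolicity cone is $\Lambda_+(p,e)=\{x\in\mathbb{R}^n : \text{all zeros of } t\mapsto p(te-x) \text{ are nonnegative}\}$, which is a closed convex cone. For $v\in\mathbb{R}^n$, $D_v^kf(x)=\frac{d^k}{dt^k}f(x+tv)\big|_{t=0}$ is the $k$th directional derivative of a polynomial $f$ in direction $v$ (with $D_v^0f=f$, $D_v=D_v^1$). If $p$ is hyperbolic with respect to $e$, then so are its directional derivatives $D_e^kp$. For $x\in\mathbb{R}^n$, $\operatorname{mult}_p(x)$ denotes the multiplicity of $0$ as a zero of $t\mapsto p(te-x)$ (it does not depend on the choice of direction of hyperbolicity $e$). If $q$ is hyperbolic with respect to $e$ and $z\in\Lambda_+(q,e)$ has $\operatorname{mult}_q(z)=1$, the tangent space to the hyperbolicity cone at $z$ is $T_z\Lambda_+(q,e)=\{x\in\mathbb{R}^n : D_xq(z)=0\}$, and $\left.H_q(z)\right|_{T_z}:T_z\Lambda_+(q,e)\to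 T_z\Lambda_+(q,e)$ denotes the self-adjoint linear map associated with the restriction of the quadratic form $x\mapsto D_x^2q(z)$ to the subspace $T_z\Lambda_+(q,e)$; equivalently, it is the Hessian at $z$ of the polynomial obtained by restricting $q$ to the subspace $T_z\Lambda_+(q,e)$. A face of a closed convex set $C\subseteq\mathbb{R}^n$ is a closed convex set $\mathcal{F}\subseteq C$ such that whenever $x,y\in C$ satisfy $\alpha x+(1-\alpha)y\in\mathcal{F}$ for some $\alpha\in(0,1)$, then $x,y\in\mathcal{F}$. The linear span of $\mathcal{F}$ is denoted $\operatorname{span}(\mathcal{F})$.
   Formalization: Adds m ≥ 1 (for m = 0, D_e^{m-1}p is undefined) and that m < d, d = deg p, or p is a constant times the d-th power of a linear form: otherwise, for m = d, the identity fails, e.g. p = x_0x_1, e = (1,1), F = {0}, z = 0. *)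

(* Defs.v *)
From HB Require Import structures.
From mathcomp Require Import all_boot all_order all_algebra.
From mathcomp Require Import all_classical all_reals topology normedtype convex.
From mathcomp Require Import complex.
(* The notations of mpoly clash with those of mathcomp-analysis, hence the
   filtered import: [mpoly n R], [meval v p] and [mderiv i p] stand for
   {mpoly R[n]}, p.@[v] and p^`M(i). *)
From mathcomp Require Import -(notations) mpoly.

Import Order.TTheory GRing.Theory Num.Theory numFieldNormedType.Exports.

Set Implicit Arguments.
Unset Strict Implicit.
Unset Printing Implicit Defensive.

Local Open Scope classical_set_scope.
Local Open Scope ring_scope.

Section Hyperbolicity.
Variables (R : realType) (n : nat).
Implicit Types (p q f : mpoly n R) (e v x z : 'rV[R]_n).

Definition pval f x : R := meval (x 0) f.

(* The univariate polynomial t |-> f(x + t v). *)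
Definition on_line f x v : {poly R} :=
  mmap (@polyC R) (fun i => (x 0 i)%:P + v 0 i *: 'X) f.

(* D_v, as an operator on polynomials; D_v^k is its k-th iterate, see
   [pval_ddirn] for the agreement with the k-th derivative at 0 along the
   line x + t v. *)
Definition ddir v f : mpoly n R := \sum_i v 0 i *: mderiv i f.

Definition ddirn (k : nat) v f : mpoly n R := iter k (ddir v) f.

Definition hyperbolic (d : nat) p e : Prop :=
  [/\ p \is ishomog1 d mdeg,
      0 < pval p e &
      forall x (w : R[i]),
        root (map_poly (real_complex R) (on_line p (- x) e)) w ->
        w \is Num.real].

(* Real zeros suffice here: for hyperbolic p there are no others. *)
Definition hyp_cone p e : set 'rV[R]_n :=
  [set x | forall t : R, root (on_line p (- x) e) t -> 0 <= t].

(* Only meaningful when p(e) <> 0, so that the polynomial is nonzero. *)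
Definition mult p e x : nat := mup 0 (on_line p (- x) e).

Definition tangent q z : set 'rV[R]_n := [set x | pval (ddir x q) z = 0].

Definition grad q z : 'rV[R]_n := \row_i pval (mderiv i q) z.

Definition hess q z : 'M[R]_n := \matrix_(i, j) pval (mderiv j (mderiv i q)) z.

(* [tangent q z] is the orthogonal complement of [grad q z]; this is the matrix
   of the orthogonal projection onto it (the identity if [grad q z = 0]). *)
Definition tangent_proj q z : 'M[R]_n :=
  let g := grad q z in 1%:M - ((g *m g^T) 0 0)^-1 *: (g^T *m g).

(* Acts on row vectors by right multiplication. Its restriction to
   [tangent q z] is the self-adjoint endomorphism of that space associated with
   the quadratic form x |-> D_x^2 q(z), see [tangent_hess_spec] and
   [tangent_hess_uniq]. *)
Definition tangent_hess q z : 'M[R]_n :=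
  tangent_proj q z *m hess q z *m tangent_proj q z.

Definition face (C F : set 'rV[R]_n) : Prop :=
  [/\ closed F, convex_set F, F `<=` C &
      forall x y (a : R), C x -> C y -> 0 < a -> a < 1 ->
        F (a *: x + (1 - a) *: y) -> F x /\ F y].

Definition lin_span (F : set 'rV[R]_n) : set 'rV[R]_n :=
  [set x | exists s : seq 'rV[R]_n,
     (forall v, v \in s -> F v) /\ x \in <<s>>%VS].

Definition aff_hull (F : set 'rV[R]_n) : set 'rV[R]_n :=
  [set x | exists k (v : 'I_k -> 'rV[R]_n) (c : 'I_k -> R),
     [/\ forall i, F (v i), \sum_i c i = 1 & x = \sum_i c i *: v i]].

Definition rel_interior (F : set 'rV[R]_n) : set 'rV[R]_n :=
  [set z | F z /\ within (aff_hull F) (nbhs z) F].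

(* A point z of maximal multiplicity d lies in the lineality space of the cone;
   there D_e^(d-1) p is linear, so its Hessian vanishes and the tangent space is
   a hyperplane, while the face through z is the lineality space. The two agree
   exactly when p is a multiple of the d-th power of a linear form; they differ
   e.g. for p = x_0 x_1, e = (1, 1), z = 0. *)
Definition linear_form_power (d : nat) p : Prop :=
  exists (c : R) (l : 'rV[R]_n),
    forall x, pval p x = c * ((x *m l^T) 0 0) ^+ d.

Lemma horner_on_line f x v (t : R) :
  (on_line f x v).[t] = pval f (x + t *: v).
Proof.
elim/mpolyind: f => [|c m f _ _ IH]; rewrite /on_line /pval.
  by rewrite mmap0 meval0 horner0.
rewrite mmapD mevalD mmapZ mevalZ hornerD hornerM hornerC mmapX mevalX.
congr (_ * _ + _); last exact: IH.
rewrite /mmap1 horner_prod; apply: eq_bigr => i _.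
by rewrite horner_exp hornerD hornerC hornerZ hornerX !mxE mulrC.
Qed.

Lemma ddir_is_linear v : linear (ddir v).
Proof.
move=> c f g; rewrite /ddir scaler_sumr -big_split; apply: eq_bigr => i _ /=.
by rewrite linearP scalerDr !scalerA mulrC.
Qed.

Lemma ddirM v f g : ddir v (f * g) = ddir v f * g + f * ddir v g.
Proof.
rewrite /ddir mulr_suml mulr_sumr -big_split; apply: eq_bigr => i _ /=.
by rewrite mderivM scalerDr scalerAl scalerAr.
Qed.

Lemma on_line_ddir f x v : on_line (ddir v f) x v = (on_line f x v)^`().
Proof.
pose P g := on_line (ddir v g) x v = (on_line g x v)^`().
have onD g h : on_line (g + h) x v = on_line g x v + on_line h x v.
  exact: mmapD.
have onM g h : on_line (g * h) x v = on_line g x v * on_line h x v.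
  by rewrite /on_line rmorphM.
have onZ c g : on_line (c *: g) x v = c%:P * on_line g x v by exact: mmapZ.
have on1 : on_line 1 x v = 1 by rewrite /on_line rmorph1.
have P1 : P 1.
  rewrite /P on1 derivC /ddir big1 ?[LHS]mmap0// => i _.
  by rewrite -mpolyC1 mderivC scaler0.
have PM g h : P g -> P h -> P (g * h).
  by rewrite /P ddirM onD !onM derivM => -> ->.
have PX i : P (mpolyX R (mnm1 i)).
  rewrite /P /ddir (bigD1 i)//= big1 => [|j ji]; last first.
    rewrite mderivX mnm1E; case: eqP => [/eqP|_]; last by rewrite scale0r scaler0.
    by rewrite eq_sym (negbTE ji).
  rewrite addr0 mderivX mnm1E eqxx scale1r.
  have -> : mnm_sub (mnm1 i) (mnm1 i) = mnm0.
    by apply/mnmP => j; rewrite mnmBE mnm0E subnn.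
  rewrite mpolyX0 onZ on1 mulr1 /on_line mmapX mmap1U.
  by rewrite derivD derivC add0r derivZ derivX alg_polyC.
have Pm m : P (mpolyX R m).
  rewrite mpolyXE_id; apply: big_ind => // i _.
  by elim: (m i) => [|k IH]; rewrite ?expr0// exprS; apply: PM.
rewrite -/(P f); elim/mpolyind: f => [|c m g _ _ IH].
  rewrite /P /ddir big1 => [|i _]; last by rewrite mderiv0 scaler0.
  by rewrite /on_line !mmap0 deriv0.
rewrite /P (ddir_is_linear v c) !onD !onZ derivD Pm IH.
by rewrite derivM derivC mul0r add0r.
Qed.

Lemma pval_ddirn k v f x : pval (ddirn k v f) x = (on_line f x v)^`(k).[0].
Proof.
have -> : (on_line f x v)^`(k) = on_line (ddirn k v f) x v.
  by elim: k => [//|k IH]; rewrite derivnS IH -on_line_ddir.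
by rewrite horner_on_line scale0r addr0.
Qed.

Lemma pval_ddir v f x :
  pval (ddir v f) x = \sum_i v 0 i * pval (mderiv i f) x.
Proof.
by rewrite /pval /ddir raddf_sum; apply: eq_bigr => i _; exact: mevalZ.
Qed.

Lemma mderiv_ddir i v f : mderiv i (ddir v f) = ddir v (mderiv i f).
Proof.
rewrite /ddir raddf_sum; apply: eq_bigr => j _ /=.
by rewrite mderivZ mderiv_comm.
Qed.

Lemma tangentE q z x : tangent q z x <-> x *m (grad q z)^T = 0.
Proof.
have E : (x *m (grad q z)^T) 0 0 = pval (ddir x q) z.
  by rewrite pval_ddir mxE; apply: eq_bigr => i _; rewrite !mxE.
split=> [h|h]; last by rewrite /tangent/= -E h mxE.
by apply/matrixP => i j; rewrite !ord1 E h mxE.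
Qed.

Lemma tangent_hess_form q z x :
  (x *m hess q z *m x^T) 0 0 = pval (ddirn 2 x q) z.
Proof.
rewrite /ddirn /= pval_ddir mxE; apply: eq_bigr => j _.
rewrite mderiv_ddir pval_ddir [X in _ * X]mxE mulrC mxE; congr (_ * _).
by apply: eq_bigr => i _; rewrite mxE mderiv_comm.
Qed.

Lemma hess_tr q z : (hess q z)^T = hess q z.
Proof. by apply/matrixP => i j; rewrite !mxE mderiv_comm. Qed.

Lemma tangent_proj_tr q z : (tangent_proj q z)^T = tangent_proj q z.
Proof.
by rewrite /tangent_proj raddfB /= tr_scalar_mx linearZ /= trmx_mul trmxK.
Qed.

Lemma tangent_proj_id q z x : tangent q z x -> x *m tangent_proj q z = x.
Proof.
move=> /tangentE h; rewrite /tangent_proj mulmxBr mulmx1 -scalemxAr mulmxA h.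
by rewrite mul0mx scaler0 subr0.
Qed.

Lemma mulmx_tr_eq0 x : (x *m x^T) 0 0 = 0 -> x = 0.
Proof.
rewrite mxE => /eqP; rewrite psumr_eq0 => [/allP x0|i _]; last first.
  by rewrite mxE -expr2 sqr_ge0.
apply/matrixP => i j; rewrite !ord1 [RHS]mxE.
by have := x0 j (mem_index_enum j); rewrite mxE mulf_eq0 orbb => /eqP.
Qed.

Lemma tangent_projP q z x : tangent q z (x *m tangent_proj q z).
Proof.
apply/tangentE; rewrite -mulmxA.
suff -> : tangent_proj q z *m (grad q z)^T = 0 by rewrite mulmx0.
rewrite /tangent_proj; set g := grad q z.
have gg : g *m g^T = ((g *m g^T) 0 0)%:M by rewrite -mx11_scalar.
have [g0|g0] := eqVneq ((g *m g^T) 0 0) 0.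
  by rewrite (mulmx_tr_eq0 g0) trmx0 mulmx0.
rewrite mulmxBl mul1mx -scalemxAl -mulmxA gg mul_mx_scalar scalerA -gg.
by rewrite mulVf // scale1r subrr.
Qed.

Lemma tangent_hess_spec q z (H := tangent_hess q z) :
  [/\ forall x, tangent q z x -> tangent q z (x *m H),
      forall x y, tangent q z x -> tangent q z y ->
        x *m H *m y^T = x *m (y *m H)^T &
      forall x, tangent q z x -> (x *m H *m x^T) 0 0 = pval (ddirn 2 x q) z].
Proof.
have HT : H^T = H.
  by rewrite /H /tangent_hess !trmx_mul tangent_proj_tr hess_tr mulmxA.
split=> [x _|x y _ _|x Tx].
- by rewrite /H /tangent_hess !mulmxA; exact: tangent_projP.
- by rewrite trmx_mul HT; exact/esym/mulmxA.
rewrite -tangent_hess_form /H /tangent_hess !mulmxA (tangent_proj_id Tx).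
have -> : x *m hess q z *m tangent_proj q z *m x^T =
    x *m hess q z *m (x *m tangent_proj q z)^T.
  by rewrite trmx_mul tangent_proj_tr !mulmxA.
by rewrite (tangent_proj_id Tx).
Qed.

Lemma tangent_hess_uniq q z (G : 'M[R]_n) :
  (forall x, tangent q z x -> tangent q z (x *m G)) ->
  (forall x y, tangent q z x -> tangent q z y ->
     x *m G *m y^T = x *m (y *m G)^T) ->
  (forall x, tangent q z x -> (x *m G *m x^T) 0 0 = pval (ddirn 2 x q) z) ->
  forall x, tangent q z x -> x *m G = x *m tangent_hess q z.
Proof.
move=> GT Gsym Gform x Tx.
have [HT Hsym Hform] := tangent_hess_spec q z.
set H := tangent_hess q z in HT Hsym Hform *.
pose K := G - H.
have TD u w : tangent q z u -> tangent q z w -> tangent q z (u + w).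
  by move=> /tangentE hu /tangentE hw; apply/tangentE; rewrite mulmxDl hu hw addr0.
have TN u : tangent q z u -> tangent q z (- u).
  by move=> /tangentE hu; apply/tangentE; rewrite mulNmx hu oppr0.
have K0 u : tangent q z u -> u *m K *m u^T = 0.
  move=> Tu; apply/matrixP => i j; rewrite !ord1 /K mulmxBr mulmxBl !mxE.
  by have := Gform _ Tu; have := Hform _ Tu; rewrite !mxE => -> ->; rewrite subrr.
have Ksym u w : tangent q z u -> tangent q z w ->
    u *m K *m w^T = w *m K *m u^T.
  move=> Tu Tw; rewrite /K !mulmxBr !mulmxBl Gsym// Hsym//.
  have tr11 (A : 'M[R]_1) : A^T = A by apply/matrixP => i j; rewrite !ord1 mxE.
  by rewrite -[u *m (w *m G)^T]tr11 -[u *m (w *m H)^T]tr11 !trmx_mul !trmxK.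
have TxK : tangent q z (x *m K).
  by rewrite /K mulmxBr; apply: TD; [exact: GT|apply: TN; exact: HT].
have : (x *m K) *m (x *m K)^T = 0.
  clearbody K; move: TxK; set y := x *m K => TxK.
  have := K0 _ (TD _ _ Tx TxK); rewrite [(x + y)^T]raddfD /= !(mulmxDl, mulmxDr).
  rewrite !K0// add0r addr0 -(Ksym x y)// -/y -mulr2n => /matrixP/(_ 0 0).
  rewrite mulmxnE [RHS]mxE => /eqP; rewrite mulrn_eq0 /= => /eqP h.
  by apply/matrixP => i j; rewrite !ord1 h mxE.
move=> /matrixP/(_ 0 0); rewrite [RHS]mxE => /mulmx_tr_eq0 y0.
by apply/eqP; rewrite -subr_eq0 -mulmxBr -/K y0.
Qed.

End Hyperbolicity.

(* Main.v *)
(* For z in the relative interior of F let m be its multiplicity and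
   q = D_e^(m-1) p, so that q(z) = 0 < D_e q(z). By Garding's theorem
   s |-> q(z + t e + s x) has only real zeros for t > 0; Laguerre's inequality
   and t -> 0 give D_x^2 q(z) <= 0 on the tangent space. If v is in F then
   z + s (v - z) stays in F for small |s|, where q is nonnegative, so v - z is
   tangent and isotropic, hence in the kernel of the Hessian.

   Conversely, for x in the kernel, D_e^k p vanishes on the line z + s x for all
   k < m. For k = m-1 the first two s-coefficients of q(z + t e + s x) are O(t),
   and real-rootedness forces this on all of them. For k = m-2 one needs in
   addition that D_x^2 D_e^(m-2) p(z) = 0, which follows from Newton's inequality
   in the two directions lam e + x and lam e - x tangent to the quadratic part;
   this is where D_e^(m+1) p(z) > 0, i.e. m < d, is used. For k < m-2, a
   real-rooted polynomial cannot have two consecutive zero coefficients unless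
   the lower ones vanish too. The coefficients of t |-> p(z + s x + t e) of
   degree at least m stay positive for small s, so z + s x and z - s x lie in the
   cone, and both are in F because F is a face. If m = d, then p is a power of a
   linear form and all D_e^k p are invariant along the kernel of this form. *)

Require Import Defs.
From HB Require Import structures.
From mathcomp Require Import all_boot all_order all_algebra.
From mathcomp Require Import all_classical all_reals topology normedtype convex.
From mathcomp Require Import polyrcf complex.
From mathcomp Require Import -(notations) mpoly.
From mathcomp Require Import ring lra zify.

Import Order.TTheory GRing.Theory Num.Theory numFieldNormedType.Exports.
Import ComplexField.Normc.

Set Implicit Arguments.
Unset Strict Implicit.
Unset Printing Implicit Defensive.

Local Open Scope classical_set_scope.
Local Open Scope ring_scope.

(** * Evaluation of homogeneous polynomials along lines *)

Lemma rmorph_mmap n (R : nzRingType) (S T : nzRingType) (phi : R -> S)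
    (y : 'I_n -> S) (psi : {rmorphism S -> T}) (f : mpoly n R) :
  psi (mmap phi y f) = mmap (psi \o phi) (psi \o y) f.
Proof.
rewrite /mmap rmorph_sum; apply: eq_bigr => m _; rewrite rmorphM /=.
by congr (_ * _); rewrite /mmap1 rmorph_prod; apply: eq_bigr => i _; rewrite rmorphXn.
Qed.

Lemma eq_mmap n (R S : nzRingType) (phi1 phi2 : R -> S) (y1 y2 : 'I_n -> S)
    (f : mpoly n R) :
  phi1 =1 phi2 -> y1 =1 y2 -> mmap phi1 y1 f = mmap phi2 y2 f.
Proof.
move=> e1 e2; rewrite /mmap; apply: eq_bigr => m _; rewrite e1; congr (_ * _).
by apply: eq_bigr => i _; rewrite e2.
Qed.

Lemma mmap_scale n (R : nzRingType) (S : comNzRingType) (phi : R -> S) d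
    (f : mpoly n R) (c : S) (y : 'I_n -> S) :
  f \is ishomog1 d mdeg ->
  mmap phi (fun i => c * y i) f = c ^+ d * mmap phi y f.
Proof.
move=> /dhomogP fd; rewrite /mmap mulr_sumr; apply: eq_big_seq => m mf.
have E : mdeg m = d by exact: fd.
rewrite mulrCA; congr (_ * _); rewrite -E mdegE /mmap1 -prodrXr -big_split.
by apply: eq_bigr => i _ /=; rewrite exprMn.
Qed.

(** Here [k] only bounds the degree, as [c] may be zero; this makes the notion multiplicative over
    any ring. *)
Definition deg_le_lead (R : nzRingType) (P : {poly R}) k c :=
  (size P <= k.+1)%N /\ P`_k = c.

Lemma deg_le_leadM (R : nzRingType) (P Q : {poly R}) j k a b :
  deg_le_lead P j a -> deg_le_lead Q k b -> deg_le_lead (P * Q) (j + k) (a * b).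
Proof.
move=> [sP <-] [sQ <-]; split.
  by move: (size_polyMleq P Q) sP sQ; lia.
rewrite coefM (bigD1 (inord j)) //= inordK ?ltnS ?leq_addr// addKn big1 ?addr0//.
move=> i; rewrite -val_eqE /= inordK ?ltnS ?leq_addr// => ij.
case: (ltngtP i j) ij => // ij _; last first.
  by rewrite nth_default ?mul0r //; exact: leq_trans sP _.
rewrite [Q`_ _]nth_default ?mulr0//; apply: leq_trans sQ _.
by move: ij; have := ltn_ord i; lia.
Qed.

Lemma deg_le_leadX (R : nzRingType) (P : {poly R}) j a k :
  deg_le_lead P j a -> deg_le_lead (P ^+ k) (j * k) (a ^+ k).
Proof.
move=> Pj; elim: k => [|k IH]; first by rewrite muln0; split; rewrite ?size_poly1// coef1.
by rewrite !exprS mulnS; exact: deg_le_leadM.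
Qed.

(** The ring [S] is general because the homotopy behind Garding's theorem uses a line whose data are
    polynomials in the parameter. *)
Lemma mmap_line_deg n (R : nzRingType) (S : comNzRingType)
    (phi : R -> S) d (f : mpoly n R) (a b : 'I_n -> S) :
  f \is ishomog1 d mdeg ->
  deg_le_lead (mmap (polyC \o phi) (fun i => (a i)%:P + b i *: 'X) f) d
    (mmap phi b f).
Proof.
move=> /dhomogP fd; rewrite /mmap big_seq [X in deg_le_lead _ _ X]big_seq.
apply: (big_rec2 (fun P c => deg_le_lead P d c)).
  by split; rewrite ?size_poly0 ?coef0.
move=> m c P mf [sP <-].
have E : mdeg m = d by exact: fd.
suff [sQ Qd] : deg_le_lead (mmap1 (fun i => (a i)%:P + b i *: 'X) m) d (mmap1 b m).
  split; last by rewrite coefD /= coefCM Qd.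
  rewrite (leq_trans (size_polyD _ _))// geq_max sP andbT /=.
  by rewrite mul_polyC (leq_trans (size_scale_leq _ _)).
rewrite -E mdegE /mmap1.
apply: (big_ind3 (fun P k c => deg_le_lead P k c)).
- by split; rewrite ?size_poly1// coef1.
- by move=> *; exact: deg_le_leadM.
move=> i _; rewrite -[X in deg_le_lead _ X]mul1n; apply: deg_le_leadX; split.
  rewrite (leq_trans (size_polyD _ _))// geq_max (leq_trans (size_polyC_leq1 _))//.
  by rewrite (leq_trans (size_scale_leq _ _))// size_polyX.
by rewrite coefD coefC coefZ coefX /= add0r mulr1.
Qed.

(** * Real-rooted polynomials *)

Section RealRooted.
Variable R : rcfType.
Implicit Types (h : {poly R}) (rs : seq R).

(** The zero polynomial qualifies, so that stability under derivation holds in every degree. *)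
Definition splits h := exists rs, h = lead_coef h *: \prod_(r <- rs) ('X - r%:P).

Lemma real_rooted_splits h :
  (forall w : R[i], root (map_poly (real_complex R) h) w -> w \is Num.real) ->
  splits h.
Proof.
have [k] := ubnP (size h); elim: k h => // k IH h hk hreal.
have [h1|h1] := leqP (size h) 1.
  exists [::]; rewrite big_nil alg_polyC.
  by rewrite [X in lead_coef X](size1_polyC h1) lead_coefC -size1_polyC.
have /closed_rootP [w hw] : size (map_poly (real_complex R) h) != 1%N.
  by rewrite size_map_poly; case: (size h) h1 => [|[|]].
have /complex_realP [r wr] := hreal _ hw.
have /factor_theorem [g hg] : root h r by move: hw; rewrite wr fmorph_root.
have h0 : h != 0 by rewrite -size_poly_gt0; exact: ltn_trans h1.
have g0 : g != 0 by apply: contraNneq h0 => g0; rewrite hg g0 mul0r.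
have [|w' gw'|rs grs] := IH g.
- by move: hk; rewrite hg size_Mmonic ?monicXsubC// size_XsubC addn2.
- by apply: hreal; rewrite hg rmorphM /= rootM gw'.
exists (r :: rs); rewrite big_cons hg lead_coef_Mmonic ?monicXsubC// {1}grs.
by rewrite mulrC scalerAr.
Qed.

(** This concerns Im (P' / P), multiplied by |P|^2 to avoid division: each term 1 / (w - r) has
    imaginary part of sign opposite to that of Im w. *)
Lemma Im_deriv_prod_XsubC rs (w : R[i])
    (P := map_poly (real_complex R) (\prod_(r <- rs) ('X - r%:P))) :
  complex.Im w != 0 ->
  (P.[w] != 0) /\
  if rs is [::] then complex.Im (P^`().[w] * (P.[w])^*%C) = 0
  else complex.Im w * complex.Im (P^`().[w] * (P.[w])^*%C) < 0.
Proof.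
rewrite /P {P} => w0; elim: rs => [|r rs [IH0 IH]].
  by rewrite big_nil rmorph1 hornerE oner_neq0 derivC hornerE mul0r.
rewrite big_cons rmorphM /=; set Q := map_poly _ _ in IH0 IH *.
rewrite rmorphB /= map_polyX map_polyC /= derivM derivXsubC mul1r !hornerE.
have wr : w - r%:C%C != 0.
  apply: contraNneq w0 => /eqP; rewrite subr_eq0 => /eqP ->; exact/eqP.
split; first by rewrite mulf_neq0.
have : complex.Im w * complex.Im (Q^`().[w] * (Q.[w])^*%C) <= 0.
  case: (rs) IH => [->|r' s /ltW//]; by rewrite mulr0.
move: IH0 w0 {IH}; case: (Q^`().[w]) => c d; case: Q.[w] => a b; case: w wr => u v /= _.
rewrite eq_complex /= negb_and => ab0 v0 h.
have ab : 0 < a ^+ 2 + b ^+ 2.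
  rewrite lt_neqAle addr_ge0 ?sqr_ge0// andbT eq_sym paddr_eq0 ?sqr_ge0//.
  by rewrite !sqrf_eq0 negb_and.
have v2 : 0 < v ^+ 2 by rewrite lt_neqAle sqr_ge0 eq_sym sqrf_eq0 v0.
set lhs := (X in X < _).
(* With Q = a + i b and Q' = c + i d, the new factor w - r multiplies the old quantity by |w - r|^2
   and adds - v^2 |Q|^2. *)
have -> : lhs = - (v ^+ 2 * (a ^+ 2 + b ^+ 2)) +
    ((u - r) ^+ 2 + v ^+ 2) * (v * (c * - b + d * a)) by rewrite /lhs; ring.
have := mulr_gt0 v2 ab; set A := _ * (_ + _) => A0.
have : ((u - r) ^+ 2 + v ^+ 2) * (v * (c * - b + d * a)) <= 0.
  by rewrite mulr_ge0_le0// addr_ge0// sqr_ge0.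
lra.
Qed.

(* Gauss-Lucas *)
Lemma splits_deriv_real h (w : R[i]) :
  splits h -> (1 < size h)%N ->
  root (map_poly (real_complex R) h^`()) w -> w \is Num.real.
Proof.
move=> [rs hrs] h1 hw; have [|w0] := boolP (w \is Num.real); first by [].
have Imw : complex.Im w != 0 by case: w w0 {hw} => a b; rewrite complex_real.
have c0 : lead_coef h != 0 by rewrite lead_coef_eq0 -size_poly_gt0 ltnW.
have [_] := Im_deriv_prod_XsubC rs Imw.
move: hw; rewrite hrs derivZ linearZ /= rootZ ?fmorph_eq0// -deriv_map.
move=> /eqP ->; rewrite mul0r /= mulr0; case: rs hrs => [hrs|]; last by rewrite ltxx.
by move: h1; rewrite hrs big_nil alg_polyC size_polyC; case: eqP.
Qed.

Lemma splits_deriv h : splits h -> splits h^`().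
Proof.
move=> hs; have [h1|h1] := leqP (size h) 1.
  exists [::]; rewrite (size1_polyC h1) derivC lead_coef0 scale0r //.
by apply: real_rooted_splits => w; exact: splits_deriv_real.
Qed.

(** As no root is zero, X - r equals - r (1 - r^-1 X); up to sign and scaling the coefficients
    become elementary symmetric functions of the inverse roots. *)
Lemma splits_norm h : splits h -> h`_0 != 0 ->
  exists2 rs, size rs = (size h).-1 & h = h`_0 *: \prod_(r <- rs) (1 - r *: 'X).
Proof.
move=> [rs hrs] h0; exists [seq r^-1 | r <- rs].
  have c0 : lead_coef h != 0.
    by rewrite lead_coef_eq0; apply: contraNneq h0 => ->; rewrite coef0.
  by rewrite size_map hrs size_scale// size_prod_XsubC.
have [c -> c0] : exists2 c, h = c *: \prod_(r <- [seq r^-1 | r <- rs]) (1 - r *: 'X) & True; last first.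
  congr (_ *: _); rewrite coefZ.
  suff -> : (\prod_(r <- [seq r^-1 | r <- rs]) (1 - r *: 'X))`_0 = 1 by rewrite mulr1.
  rewrite -horner_coef0 horner_prod big1// => i _; rewrite !hornerE; ring.
have : {in rs, forall r, r != 0}.
  move=> r rrs; apply: contraNneq h0 => r0; rewrite hrs -horner_coef0 hornerZ.
  by rewrite horner_prod (big_rem _ rrs) /= r0 hornerXsubC subr0 mul0r mulr0 eqxx.
rewrite hrs; move: (lead_coef h) => c {hrs h0}.
elim: rs c => [|r rs IH] c rs0; first by exists c; rewrite ?big_nil.
have r0 : r != 0 by apply: rs0; rewrite inE eqxx.
have [|c' e _] := IH (- r * c); first by move=> s srs; apply: rs0; rewrite inE srs orbT.
exists c' => //; rewrite /= !big_cons [RHS]scalerAr -e.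
have rV : r%:P * (r^-1)%:P = 1 :> {poly R} by rewrite -polyCM divff.
rewrite -!mul_polyC rmorphM rmorphN /=; set P := \prod_(_ <- _) _.
rewrite [RHS](_ : _ = (r%:P * (r^-1)%:P * 'X - r%:P) * (c%:P * P)); last by ring.
by rewrite rV mul1r mulrCA.
Qed.

(** Newton's identity for the second power sum. *)
Lemma newton_prod rs (P := \prod_(r <- rs) (1 - r *: 'X)) :
  P`_0 = 1 /\ P`_1 ^+ 2 - 2 * P`_2 = \sum_(r <- rs) r ^+ 2.
Proof.
rewrite /P {P}; elim: rs => [|r rs [IH0 IH]].
  by rewrite !big_nil !coef1; split=> //=; ring.
rewrite !big_cons -IH mulrBl mul1r -scalerAl !coefB !coefZ !coefXM /= IH0.
split; ring.
Qed.

Lemma coef_prod_bound rs (M : R) j : 0 <= M -> (forall r, r \in rs -> `|r| <= M) ->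
  `|(\prod_(r <- rs) (1 - r *: 'X))`_j| <= 2 ^+ size rs * M ^+ j.
Proof.
move=> M0; elim: rs j => [|r rs IH] j rsM.
  rewrite big_nil coef1 mul1r; case: j => [|j] /=; first by rewrite normr1.
  by rewrite normr0 exprn_ge0.
have {}IH k : `|(\prod_(r <- rs) (1 - r *: 'X))`_k| <= 2 ^+ size rs * M ^+ k.
  by apply: IH => s srs; apply: rsM; rewrite inE srs orbT.
have r_le : `|r| <= M by apply: rsM; rewrite inE eqxx.
rewrite big_cons mulrBl mul1r -scalerAl coefB coefZ coefXM.
rewrite (le_trans (ler_normB _ _))// normrM /= exprS -mulrA mulr_natl mulr2n lerD//.
case: j => [|j] /=.
  by rewrite normr0 mulr0 !mulr_ge0 ?exprn_ge0 ?ler0n.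
by rewrite exprS mulrCA ler_pM.
Qed.

(** For h_0 nonzero the difference of the two sides is h_0^2 times the sum of the squared inverse
    roots. *)
Lemma splits_laguerre h : splits h -> 2 * h`_0 * h`_2 <= h`_1 ^+ 2.
Proof.
move=> hs; have [->|h0] := eqVneq h`_0 0; first by rewrite mulr0 mul0r sqr_ge0.
have [rs _ hrs] := splits_norm hs h0; have [P0 P1] := newton_prod rs.
rewrite -subr_ge0 hrs !coefZ P0 (_ : _ - _ = h`_0 ^+ 2 * \sum_(r <- rs) r ^+ 2).
  apply: mulr_ge0; first exact: sqr_ge0.
  by apply: sumr_ge0 => r _; exact: sqr_ge0.
by rewrite -P1; ring.
Qed.

(** With h_0 nonzero the squared inverse roots would sum to zero and [h] would be constant. *)
Lemma splits_laguerre_strict h : splits h -> (1 < size h)%N ->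
  h`_1 = 0 -> h`_2 = 0 -> h`_0 = 0.
Proof.
move=> hs h1 e1 e2; apply/eqP/negPn/negP => h0.
have [rs srs hrs] := splits_norm hs h0; have [P0 P1] := newton_prod rs.
have : \sum_(r <- rs) r ^+ 2 = 0.
  move: e1 e2; rewrite hrs !coefZ -P1.
  move=> /eqP; rewrite mulf_eq0 => /orP[/eqP h00|/eqP ->].
    by rewrite h00 eqxx in h0.
  move=> /eqP; rewrite mulf_eq0 => /orP[/eqP h00|/eqP ->].
    by rewrite h00 eqxx in h0.
  by rewrite mulr0 subr0 expr0n.
move=> /eqP; rewrite psumr_eq0 => [/allP rs0|r _]; last exact: sqr_ge0.
have r0 r : r \in rs -> r = 0 by move=> /rs0; rewrite sqrf_eq0 => /eqP.
have : size h = 1%N.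
  rewrite hrs big_seq big1 => [|r /r0 ->]; last by rewrite scale0r subr0.
  by rewrite alg_polyC size_polyC h0.
by move=> hs1; rewrite hs1 in h1.
Qed.

(** If S is the sum of the squared inverse roots, each of them is at most 1 + S in absolute value.
    Multiplying by h_0^(2j) clears denominators, so that the bound remains usable as h_0 tends to
    0. *)
Lemma splits_coef_bound h j : splits h -> h`_0 != 0 ->
  `|h`_j| * h`_0 ^+ (2 * j) <=
  2 ^+ size h * `|h`_0| * (h`_0 ^+ 2 + (h`_1 ^+ 2 - 2 * h`_0 * h`_2)) ^+ j.
Proof.
move=> hs h0; have [rs srs hrs] := splits_norm hs h0.
have [P0 P1] := newton_prod rs.
pose S := \sum_(r <- rs) r ^+ 2.
have S0 : 0 <= S by apply: sumr_ge0 => r _; exact: sqr_ge0.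
have -> : h`_0 ^+ 2 + (h`_1 ^+ 2 - 2 * h`_0 * h`_2) = h`_0 ^+ 2 * (1 + S).
  by rewrite {2 3 4}hrs !coefZ P0 /S -P1; ring.
rewrite exprMn -exprM [leLHS]mulrC.
rewrite [leRHS](_ : _ = h`_0 ^+ (2 * j) * (`|h`_0| * (2 ^+ size h * (1 + S) ^+ j))); last by ring.
have h2 : 0 <= h`_0 ^+ (2 * j) by rewrite exprM exprn_ge0 ?sqr_ge0.
rewrite ler_wpM2l// {1}hrs coefZ normrM ler_wpM2l//.
apply: le_trans (coef_prod_bound (M := 1 + S) j _ _) _.
- by rewrite addr_ge0.
- move=> r rrs; have : r ^+ 2 <= S.
    rewrite /S (big_rem _ rrs) /= lerDl; apply: sumr_ge0 => s _; exact: sqr_ge0.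
  by rewrite -real_normK ?num_real//; have := normr_ge0 r; nra.
rewrite ler_wpM2r ?exprn_ge0 ?addr_ge0// srs.
by rewrite ler_weXn2l ?leq_pred// ler1n.
Qed.

(** Each factor is X plus a nonnegative constant; such factors keep coefficients nonnegative and the
    positive ones an interval of degrees reaching the top. *)
Lemma splits_coef_ge0 h : splits h -> 0 < lead_coef h ->
  (forall t, root h t -> t <= 0) ->
  (forall i, 0 <= h`_i) /\ (forall i, 0 < h`_i -> (i.+1 < size h)%N -> 0 < h`_i.+1).
Proof.
move=> [rs hrs] c0 hroot.
have rs0 r : r \in rs -> r <= 0.
  by move=> rrs; apply: hroot; rewrite hrs rootZ ?gt_eqF// root_prod_XsubC.
have -> : size h = (size rs).+1 by rewrite hrs size_scale ?gt_eqF// size_prod_XsubC.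
suff [P0 P1] : (forall i, 0 <= (\prod_(r <- rs) ('X - r%:P))`_i) /\
   (forall i, 0 < (\prod_(r <- rs) ('X - r%:P))`_i -> (i < size rs)%N ->
    0 < (\prod_(r <- rs) ('X - r%:P))`_i.+1).
  rewrite hrs; split=> i; rewrite !coefZ; first exact: mulr_ge0 (ltW c0) (P0 i).
  by rewrite !pmulr_rgt0//; exact: P1.
elim: rs rs0 {hrs hroot} => [|r rs IH] rs0.
  by rewrite big_nil; split=> // i; rewrite coef1; case: eqP.
have [|P0 P1] := IH; first by move=> s srs; apply: rs0; rewrite inE srs orbT.
have r0 : 0 <= - r by rewrite oppr_ge0 rs0// inE eqxx.
rewrite big_cons; set P := \prod_(_ <- _) _ in P0 P1 *.
have E i : (('X - r%:P) * P)`_i = (if i is j.+1 then P`_j else 0) + - r * P`_i.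
  by rewrite mulrBl coefB coefXM coefCM mulNr; case: i.
split=> i; first by rewrite E addr_ge0 ?mulr_ge0//; case: i.
rewrite !E /= ltnS => hi ik.
have [Pi|Pi] := ltrP 0 P`_i; first by rewrite ltr_pwDl// mulr_ge0.
have {Pi}Pi : P`_i = 0 by apply/le_anti; rewrite Pi P0.
case: i Pi hi ik => [|i] Pi; rewrite Pi mulr0 addr0 ?ltxx// => hi ik.
by have := P1 i hi ik; rewrite Pi ltxx.
Qed.

End RealRooted.

(** * Real polynomials near zero *)

Section PolyAtZero.
Variable R : rcfType.
Implicit Types (P Q A B D : {poly R}).

Lemma horner_gt0_near0 P : 0 < P`_0 ->
  exists2 x : R, 0 < x & forall t : R, `|t| < x -> 0 < P.[t].
Proof.
rewrite -horner_coef0 => P0; have [x x0 xP] := poly_cont 0 P P0.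
exists x => // t tx; have := xP t; rewrite subr0 => /(_ tx).
by rewrite ltr_norml; lra.
Qed.

Lemma horner_ge0_at0 P : (forall t : R, 0 < t -> 0 <= P.[t]) -> 0 <= P`_0.
Proof.
move=> P0; rewrite leNgt; apply/negP => Plt.
have [|x x0 xP] := @horner_gt0_near0 (- P); first by rewrite coefN oppr_gt0.
have x2 : 0 < x / 2 by rewrite divr_gt0.
have : 0 < (- P).[x / 2] by apply: xP; rewrite ger0_norm; lra.
by rewrite hornerN oppr_gt0 ltNge P0.
Qed.

Lemma factorX P : P`_0 = 0 -> exists2 Q : {poly R}, P = Q * 'X & forall i, Q`_i = P`_i.+1.
Proof.
move=> P0; exists (drop_poly 1 P) => [|i]; last by rewrite coef_drop_poly addn1.
rewrite -{1}(poly_take_drop 1 P) expr1 (_ : take_poly 1 P = 0) ?add0r//.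
by apply/polyP => -[|i]; rewrite coef_take_poly coef0.
Qed.

(** Writing A = X U and B = X V and dividing by t leaves U D <= t V^2; then t tends to 0. *)
Lemma laguerre_at0 A B D : A`_0 = 0 -> B`_0 = 0 ->
  (forall t : R, 0 < t -> A.[t] * D.[t] <= B.[t] ^+ 2) -> A`_1 * D`_0 <= 0.
Proof.
move=> /factorX [U -> <-] /factorX [V -> _] h.
rewrite -oppr_ge0 -!horner_coef0.
rewrite (_ : - _ = ('X * V ^+ 2 - U * D).[0]); last first.
  by rewrite !(hornerD, hornerN, horner_exp, hornerM, hornerX); ring.
rewrite horner_coef0; apply: horner_ge0_at0 => t t0.
rewrite -(pmulr_rge0 _ t0); have := h t t0.
rewrite !(hornerD, hornerN, horner_exp, hornerM, hornerX) -subr_ge0.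
by congr (0 <= _); ring.
Qed.

Lemma laguerre_at0_double A B D : A`_0 = 0 -> A`_1 = 0 -> B`_0 = 0 ->
  (forall t : R, 0 < t -> A.[t] * D.[t] <= B.[t] ^+ 2) -> A`_2 * D`_0 <= B`_1 ^+ 2.
Proof.
move=> /factorX [U' -> U'E]; rewrite -!U'E => /factorX [U -> <-].
move=> /factorX [V -> <-] h.
rewrite -subr_ge0 -!horner_coef0 -horner_exp -hornerM -hornerN -hornerD horner_coef0.
apply: horner_ge0_at0 => t t0.
rewrite -(pmulr_rge0 _ (exprn_gt0 2 t0)); have := h t t0.
rewrite !(hornerD, hornerN, horner_exp, hornerM, hornerX) -subr_ge0.
by congr (0 <= _); ring.
Qed.

(** Being O(t^k) from the right kills the coefficients below degree k one at a time; squaring turns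
    the absolute values into polynomials. *)
Lemma dvdpXn_le P Q k : (forall t : R, 0 < t -> `|P.[t]| <= t ^+ k * `|Q.[t]|) ->
  'X^k %| P.
Proof.
elim: k P => [|k IH] P PQ; first by rewrite expr0 dvd1p.
have P0 : P`_0 = 0.
  have : 0 <= ('X ^+ (2 * k.+1) * Q ^+ 2 - P ^+ 2)`_0.
    apply: horner_ge0_at0 => t t0.
    rewrite !(hornerD, hornerN, horner_exp, hornerM, hornerX) subr_ge0.
    rewrite -(real_normK (num_real P.[t])) -(real_normK (num_real Q.[t])).
    by rewrite mulnC exprM -exprMn lerXn2r ?PQ ?nnegrE// mulr_ge0// exprn_ge0// ltW.
  rewrite -horner_coef0 !(hornerD, hornerN, horner_exp, hornerM, hornerX) /=.
  rewrite expr0n /= mul0r sub0r oppr_ge0 horner_coef0 => h.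
  by apply/eqP; rewrite -sqrf_eq0 eq_le h sqr_ge0.
have [P' PE _] := factorX P0; rewrite PE exprSr dvdp_mul2r ?polyX_eq0//.
apply: IH => t t0; rewrite -(ler_pM2r t0).
have := PQ t t0; rewrite PE hornerM hornerX normrM (gtr0_norm t0) => /le_trans; apply.
by rewrite exprSr mulrAC.
Qed.

Lemma horner_eq0 P : (forall t : R, P.[t] = 0) -> P = 0.
Proof.
move=> P0; apply/eqP; apply: contraT => PN0.
have := @max_poly_roots _ P [seq k%:R | k <- iota 0 (size P)] PN0.
rewrite size_map size_iota ltnn; apply: contraPP => _; apply/not_implyP; split.
  by apply/allP => s _; apply/rootP.
apply/not_implyP; split=> //.
by rewrite map_inj_uniq ?iota_uniq// => a b /eqP; rewrite eqr_nat => /eqP.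
Qed.

Lemma dvdpXn_coef P k i : 'X^k %| P -> (i < k)%N -> P`_i = 0.
Proof. by move=> /dvdpP [Q ->] ik; rewrite coefMXn ik. Qed.

Lemma dvdpXnP P k : (forall i, (i < k)%N -> P`_i = 0) -> 'X^k %| P.
Proof.
move=> h; rewrite -(poly_take_drop k P) dvdp_addr ?dvdp_mull//.
suff -> : take_poly k P = 0 by exact: dvdp0.
by apply/polyP => i; rewrite coef_take_poly coef0; case: ltnP => // /h.
Qed.

End PolyAtZero.

(** * Roots of a one-parameter family in the upper half plane *)

Section Homotopy.
Variable R : realType.
Local Notation C := R[i].
Local Notation toC := (real_complex R).
Implicit Types (P : {poly C}) (L : {poly {poly C}}) (s w : C) (b : R).

Lemma normc_ge0 s : 0 <= normc s.
Proof. by case: s => x y; exact: sqrtr_ge0. Qed.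

Lemma normc_ge_Im s : `|complex.Im s| <= normc s.
Proof.
case: s => x y /=; rewrite -sqrtr_sqr ler_wsqrtr// lerDr; exact: sqr_ge0.
Qed.

Lemma normc_real b : normc (toC b) = `|b|.
Proof. by rewrite /= expr0n /= addr0 sqrtr_sqr. Qed.

Lemma normc_prod I (rs : seq I) (F : I -> C) :
  normc (\prod_(i <- rs) F i) = \prod_(i <- rs) normc (F i).
Proof. exact: (big_morph _ (@normcM _) (@normc1 _)). Qed.

Lemma normc_horner_roots P s : exists rs : seq C,
  [/\ size rs = (size P).-1, forall w, w \in rs -> P = 0 \/ root P w &
    normc P.[s] = normc (lead_coef P) * \prod_(w <- rs) normc (s - w)].
Proof.
have [rs Prs] := closed_field_poly_normal P.
have [P0|P0] := eqVneq P 0.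
  exists [::]; split=> //; first by rewrite P0 size_poly0.
  by rewrite P0 lead_coef0 horner0 big_nil mulr1.
exists rs; split.
- by rewrite {1}Prs size_scale ?lead_coef_eq0// size_prod_XsubC.
- move=> w wrs; right; rewrite Prs rootZ ?lead_coef_eq0//.
  by rewrite root_prod_XsubC.
rewrite {1}Prs hornerZ horner_prod normcM normc_prod; congr (_ * _).
by apply: eq_bigr => w _; rewrite hornerXsubC.
Qed.

(** Used in contrapositive form: a small value of [P] at [s] gives a root near [s]. *)
Lemma root_dist P s (x : R) : 0 <= x ->
  (forall w, root P w -> x <= normc (s - w)) ->
  normc (lead_coef P) * x ^+ (size P).-1 <= normc P.[s].
Proof.
move=> x0 xle; have [->|P0] := eqVneq P 0.
  by rewrite lead_coef0 normc0 mul0r normc_ge0.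
have [rs [<- rsP ->]] := normc_horner_roots P s.
rewrite ler_wpM2l ?normc_ge0//.
have {}rsP w : w \in rs -> root P w by move=> /rsP[/eqP|//]; rewrite (negPf P0).
elim: rs rsP => [|w rs IH] rsP; first by rewrite big_nil.
rewrite big_cons /= exprS ler_pM ?exprn_ge0//.
  by apply/xle/rsP; rewrite inE eqxx.
by apply: IH => v vrs; apply: rsP; rewrite inE vrs orbT.
Qed.

Lemma lower_bound_upper_half_plane P : P != 0 ->
  (forall w, root P w -> complex.Im w < 0) ->
  exists2 k : R, 0 < k & forall s, 0 <= complex.Im s ->
    k * (1 + normc s) ^+ (size P).-1 <= normc P.[s].
Proof.
move=> P0 rP; have [rs Prs] := closed_field_poly_normal P.
have lP : lead_coef P != 0 by rewrite lead_coef_eq0.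
have {}rP w : w \in rs -> complex.Im w < 0.
  by move=> wrs; apply: rP; rewrite Prs rootZ// root_prod_XsubC.
have -> : (size P).-1 = size rs by rewrite {1}Prs size_scale// size_prod_XsubC.
suff [k k0 kP] : exists2 k : R, 0 < k & forall s, 0 <= complex.Im s ->
    k * (1 + normc s) ^+ size rs <= normc (\prod_(w <- rs) ('X - w%:P)).[s].
  exists (normc (lead_coef P) * k).
    rewrite mulr_gt0// lt_neqAle normc_ge0 andbT eq_sym.
    by apply: contraNneq lP => /eq0_normc ->.
  move=> s s0; rewrite [in leRHS]Prs hornerZ normcM -mulrA ler_wpM2l ?normc_ge0//.
  exact: kP.
elim: rs rP {Prs lP} => [|w rs IH] rP.
  by exists 1 => // s _; rewrite big_nil hornerC normc1 mul1r.
have [|k k0 kP] := IH; first by move=> v vrs; apply: rP; rewrite inE vrs orbT.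
have w0 : 0 < - complex.Im w by rewrite oppr_gt0 rP// inE eqxx.
(* From - Im w <= |s - w| and |s| <= |w| + |s - w| follows 1 + |s| <= x |s - w|. *)
pose x := (1 + normc w) / - complex.Im w + 1.
have x0 : 0 < x by rewrite ltr_wpDl// divr_ge0 ?ltW// ltr_wpDr ?normc_ge0.
exists (x^-1 * k); first by rewrite mulr_gt0 ?invr_gt0.
move=> s s0; rewrite big_cons hornerM hornerXsubC normcM /= exprS mulrACA.
rewrite ler_pM ?kP//.
- by rewrite mulr_ge0 ?invr_ge0 ?ltW// ltr_wpDr ?normc_ge0.
- by rewrite mulr_ge0 ?(ltW k0)// exprn_ge0// addr_ge0 ?normc_ge0.
rewrite mulrC ler_pdivrMr// mulrDr mulr1.
have sw1 : - complex.Im w <= normc (s - w).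
  apply: le_trans (normc_ge_Im _); apply: le_trans (ler_norm _).
  by case: (s) s0 => a b /= b0; case: (w) => c d /=; rewrite lerDr.
have sw2 : normc s <= normc w + normc (s - w).
  by have := le_normcD w (s - w); rewrite addrC subrK.
have : 1 + normc w <= normc (s - w) * ((1 + normc w) / - complex.Im w).
  rewrite mulrCA ler_peMr//; first by rewrite addr_ge0 ?normc_ge0.
  by rewrite ler_pdivlMr// mul1r.
by move: sw2; lra.
Qed.

Lemma horner_bound_itv P : exists2 k : R, 0 <= k & forall b, 0 <= b <= 1 ->
  normc P.[toC b] <= k.
Proof.
elim/poly_ind: P => [|P c [k k0 kP]].
  by exists 0 => // b _; rewrite horner0 normc0.
exists (k + normc c) => [|b b01]; first by rewrite addr_ge0 ?normc_ge0.
rewrite hornerMXaddC (le_trans (le_normcD _ _))// lerD2r normcM normc_real.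
have /andP[b0 b1] := b01; rewrite ger0_norm// -[k]mulr1.
by rewrite ler_pM ?normc_ge0 ?kP.
Qed.

Lemma horner_lipschitz_itv P : exists2 k : R, 0 <= k &
  forall a b, 0 <= a <= 1 -> 0 <= b <= 1 ->
    normc (P.[toC b] - P.[toC a]) <= k * `|b - a|.
Proof.
elim/poly_ind: P => [|P c [k k0 kP]].
  by exists 0 => // a b _ _; rewrite !horner0 subr0 normc0 mul0r.
have [l l0 lP] := horner_bound_itv P.
exists (k + l) => [|a b a01 b01]; first by rewrite addr_ge0.
rewrite !hornerMXaddC (_ : _ - _ = (P.[toC b] - P.[toC a]) * toC b
   + P.[toC a] * toC (b - a)); last by rewrite rmorphB /=; ring.
rewrite (le_trans (le_normcD _ _))// !normcM !normc_real mulrDl lerD//.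
  have /andP[b0 b1] := b01; rewrite (ger0_norm b0) -[leRHS]mulr1.
  by rewrite ler_pM ?normc_ge0 ?kP.
by rewrite ler_wpM2r ?lP.
Qed.

(** The growth in [s] has the order of the lower bound in [lower_bound_upper_half_plane], so the two
    compare uniformly on the unbounded half plane. *)
Lemma horner2_lipschitz_itv L n : (size L <= n.+1)%N ->
  exists2 k : R, 0 <= k & forall a b s, 0 <= a <= 1 -> 0 <= b <= 1 ->
    normc (L.[s%:P].[toC b] - L.[s%:P].[toC a]) <=
    k * `|b - a| * (1 + normc s) ^+ n.
Proof.
elim/poly_ind: L n => [|L P IH] n sL.
  exists 0 => // a b s _ _; rewrite !horner0 subr0 normc0 !mul0r//.
have [k k0 kP] := horner_lipschitz_itv P.
have s1 s : 1 <= (1 + normc s) by rewrite lerDl normc_ge0.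
have E s b : (L * 'X + P%:P).[s%:P].[toC b] = L.[s%:P].[toC b] * s + P.[toC b].
  by rewrite hornerMXaddC hornerD hornerM hornerC.
case: n sL => [|n] sL.
  exists k => // a b s a01 b01; rewrite !E expr0 mulr1.
  suff -> : L = 0 by rewrite !horner0 !mul0r !add0r kP.
  apply/eqP; apply: contraTT sL => L0.
  by rewrite size_MXaddC (negPf L0) /= ltnS -ltnNge size_poly_gt0.
have [|l l0 lP] := IH n.
  by move: sL; rewrite size_MXaddC; case: eqP => [->|//]; rewrite size_poly0.
exists (l + k) => [|a b s a01 b01]; first by rewrite addr_ge0.
rewrite !E (_ : _ - _ = (L.[s%:P].[toC b] - L.[s%:P].[toC a]) * s +
  (P.[toC b] - P.[toC a])); last by ring.
rewrite (le_trans (le_normcD _ _))// [(l + k) * _]mulrDl [leRHS]mulrDl lerD//.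
  rewrite normcM exprSr mulrA ler_pM ?normc_ge0 ?lP//.
  by rewrite lerDr.
rewrite (le_trans (kP _ _ a01 b01))// ler_peMr ?mulr_ge0//.
by rewrite exprn_ege1.
Qed.

(* The parameters b for which L(., b) has a root in the closed upper half plane
   form an open set, as no root lies on the real axis, and a closed one, as
   |L(s, b)| is bounded below there by a multiple of (1 + |s|) ^ n when all the
   roots of L(., b) are in the open lower half plane. *)
Lemma root_free_homotopy L n (c : C) :
  (size L <= n.+1)%N -> L`_n = c%:P -> c != 0 ->
  (forall b r : R, 0 < b -> b <= 1 -> L.[(toC r)%:P].[toC b] != 0) ->
  (forall s, 0 <= complex.Im s -> L.[s%:P].[toC 1] != 0) ->
  forall s, 0 < complex.Im s -> L.[s%:P].[toC 0] != 0.
Proof.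
move=> sL Ln c0 Lreal L1 s0 s0gt; apply/negP => /eqP Ls0.
have [k k0 kP] := horner2_lipschitz_itv sL.
(* The inner variable of [L] is b, the outer one s. The leading coefficient in s is the constant
   [c], so the degree does not drop as b varies. *)
pose Lb b := map_poly (horner_eval (toC b)) L.
have LbE b s : (Lb b).[s] = L.[s%:P].[toC b].
  by rewrite -[RHS]/(horner_eval (toC b) _) -horner_map /= /horner_eval hornerC.
have sLb b : size (Lb b) = n.+1.
  apply/eqP; rewrite eqn_leq (leq_trans (size_poly _ _))//=.
  by rewrite ltnNge; apply/negP => /leq_sizeP/(_ n (leqnn n)) /eqP;
    rewrite coef_map /= Ln /horner_eval hornerC (negPf c0).
have lLb b : lead_coef (Lb b) = c.
  by rewrite lead_coefE sLb coef_map /= Ln /horner_eval hornerC.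
have Lb0 b : Lb b != 0 by rewrite -size_poly_gt0 sLb.
pose A : set R := [set b | 0 <= b <= 1 /\
  exists2 s, 0 <= complex.Im s & root (Lb b) s].
have A0 : A 0.
  split; first by rewrite lexx ler01.
  by exists s0; [exact: ltW|apply/rootP; rewrite LbE].
have supA : has_sup A.
  by split; [exists 0|exists 1 => b [/andP[]]].
pose u := sup A.
have u0 : 0 <= u by exact: ub_le_sup (proj2 supA) _ A0.
have u1 : u <= 1 by apply: ge_sup; [exists 0|move=> b [/andP[]]].
have u01 : 0 <= u <= 1 by rewrite u0.
(* If [u] is in [A], openness yields a larger element of [A]; otherwise closedness is contradicted
   at [u]. *)
have [[_ [s sge /rootP]]|uA] := pselect (A u).
  rewrite LbE => Ls.
  have ult1 : u < 1.
    by rewrite lt_neqAle u1 andbT; apply/eqP => uE; move: (L1 _ sge); rewrite -uE Ls eqxx.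
  have [s1 s1gt Ls1] : exists2 s, 0 < complex.Im s & L.[s%:P].[toC u] = 0.
    have [u00|une0] := eqVneq u 0; first by exists s0; rewrite ?u00.
    exists s => //; rewrite lt_neqAle sge andbT eq_sym; apply/eqP => sim.
    have := Lreal u (complex.Re s); rewrite lt_neqAle eq_sym une0 u0 => /(_ isT u1).
    have -> : toC (complex.Re s) = s by case: (s) sim => x y /= ->.
    by rewrite Ls eqxx.
  pose y := complex.Im s1 / 2.
  have y0 : 0 < y by rewrite divr_gt0.
  pose K := k * (1 + normc s1) ^+ n + 1.
  have K0 : 0 < K.
    by rewrite ltr_wpDl// mulr_ge0// exprn_ge0// addr_ge0 ?normc_ge0.
  have nc0 : 0 < normc c.
    by rewrite lt_neqAle normc_ge0 andbT eq_sym; apply: contraNneq c0 => /eq0_normc ->.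
  (* This [x] keeps u + x <= 1 and makes |L(s1, u + x)| < |c| y^n, so some root lies within [y] of
     [s1], hence above the real axis. *)
  pose x := Num.min (1 - u) (normc c * y ^+ n / K / 2).
  have x0 : 0 < x.
    rewrite /x lt_min subr_gt0 ult1 !divr_gt0// mulr_gt0// exprn_gt0//.
  have b01 : 0 <= u + x <= 1.
    by rewrite addr_ge0 ?(ltW x0)//= -lerBrDl /x ge_min lexx.
  suff : A (u + x).
    move=> /(ub_le_sup (proj2 supA)); rewrite -/u gerDl.
    by rewrite leNgt x0.
  split=> //; apply: contrapT => noroot.
  have := @root_dist (Lb (u + x)) s1 y (ltW y0).
  rewrite lLb sLb /=; apply/not_implyP; split.
    move=> w wroot; rewrite leNgt; apply/negP => wy; apply: noroot.
    exists w => //; have : `|complex.Im (s1 - w)| < y.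
      exact: le_lt_trans (normc_ge_Im _) wy.
    move=> /(le_lt_trans (ler_norm _)).
    rewrite /y; case: (s1) s1gt => a1 b1; case: (w) => a2 b2 /=; lra.
  apply/negP; rewrite -ltNge LbE.
  have := kP u (u + x) s1 u01 b01; rewrite Ls1 subr0 (_ : u + x - u = x); last by ring.
  move=> /le_lt_trans; apply.
  rewrite ger0_norm ?(ltW x0)// mulrAC.
  apply: (@le_lt_trans _ _ (K * x)).
    by rewrite ler_wpM2r ?(ltW x0)// /K lerDl.
  apply: (@le_lt_trans _ _ (K * (normc c * y ^+ n / K / 2))).
    by rewrite ler_wpM2l ?(ltW K0)// /x ge_min lexx orbT.
  have := mulr_gt0 nc0 (exprn_gt0 n y0); set Z := normc c * _ => Z0.
  rewrite (_ : K * _ = Z / 2); last by field; rewrite gt_eqF.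
  lra.
have uroot w : root (Lb u) w -> complex.Im w < 0.
  move=> wr; rewrite ltNge; apply/negP => w0; apply: uA; split=> //.
  by exists w.
have [l l0 lP] := lower_bound_upper_half_plane (Lb0 u) uroot.
(* A root s of [Lb b] in the closed upper half plane gives l (1 + |s|)^n <= k (u - b) (1 + |s|)^n,
   impossible when u - b < l / (k + 1). *)
have x0 : 0 < l / (k + 1) by rewrite divr_gt0// ltr_wpDl.
have [b [b01 [s sge /rootP sroot]] ub] := sup_adherent x0 supA.
have bu : b <= u by apply: ub_le_sup (proj2 supA) _ _; split=> //; exists s => //; apply/rootP.
have := kP u b s u01 b01; rewrite -!LbE sroot sub0r normcN.
have := lP _ sge; rewrite sLb /= => h1 h2; have := le_trans h1 h2.
have s1 : 0 < (1 + normc s) ^+ n by rewrite exprn_gt0// ltr_wpDr ?normc_ge0.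
rewrite ler_pM2r// leNgt => /negP; apply.
rewrite distrC ger0_norm ?subr_ge0//.
have ubx : u - b < l / (k + 1) by move: ub; rewrite -/u; lra.
apply: (@le_lt_trans _ _ ((k + 1) * (u - b))).
  by rewrite ler_wpM2r ?subr_ge0// lerDl.
by rewrite mulrC -ltr_pdivlMr// ltr_wpDl.
Qed.

End Homotopy.

(** * Garding's theorem *)

Section LineRestriction.
Variables (R : realType) (n : nat).
Local Notation C := R[i].
Local Notation toC := (real_complex R).
Implicit Types (f g p : mpoly n R) (e v x y z : 'rV[R]_n).

Lemma pval_scale d f (c : R) x :
  f \is ishomog1 d mdeg -> pval f (c *: x) = c ^+ d * pval f x.
Proof.
move=> fd; rewrite /pval /meval -(mmap_scale _ _ _ fd).
by apply: eq_mmap => // i; rewrite mxE.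
Qed.

Lemma pval_opp d f x :
  f \is ishomog1 d mdeg -> pval f (- x) = (-1) ^+ d * pval f x.
Proof. by move=> fd; rewrite -(pval_scale _ _ fd) scaleN1r. Qed.

Lemma on_line_deg d f x v :
  f \is ishomog1 d mdeg -> deg_le_lead (on_line f x v) d (pval f v).
Proof. by move=> fd; exact: (@mmap_line_deg n R R idfun d f _ _ fd). Qed.

Lemma complex_on_line f x v (w : C) :
  (map_poly toC (on_line f x v)).[w] =
  mmap toC (fun i => toC (x 0 i) + toC (v 0 i) * w) f.
Proof.
rewrite /on_line rmorph_mmap -[LHS]/(horner_eval w _) rmorph_mmap.
apply: eq_mmap => [c|i] /=; rewrite /horner_eval.
  by rewrite map_polyC hornerC.
by rewrite rmorphD /= linearZ /= map_polyC map_polyX !hornerE.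
Qed.

Lemma coef_on_line k f x v :
  (on_line f x v)`_k *+ k`! = pval (ddirn k v f) x.
Proof. by rewrite pval_ddirn horner_coef0 coef_derivn addn0 ffactnn. Qed.

Lemma coef_on_line_eq0 k f x v :
  ((on_line f x v)`_k == 0) = (pval (ddirn k v f) x == 0).
Proof. by rewrite -coef_on_line mulrn_eq0 -leqn0 leqNgt fact_gt0. Qed.

Lemma coef_on_line_gt0 k f x v :
  (0 < (on_line f x v)`_k) = (0 < pval (ddirn k v f) x).
Proof. by rewrite -coef_on_line pmulrn_lgt0 ?fact_gt0. Qed.

Lemma coef_on_line_ge0 k f x v :
  (0 <= (on_line f x v)`_k) = (0 <= pval (ddirn k v f) x).
Proof. by rewrite -coef_on_line pmulrn_lge0 ?fact_gt0. Qed.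

Lemma on_line_ddirn k f x v : on_line (ddirn k v f) x v = (on_line f x v)^`(k).
Proof. by elim: k => [//|k IH]; rewrite derivnS -IH -on_line_ddir. Qed.

Lemma ddir_homog d f v :
  f \is ishomog1 d.+1 mdeg -> ddir v f \is ishomog1 d mdeg.
Proof.
move=> /dhomogP fd; apply: rpred_sum => i _; apply: rpredZ.
apply/dhomogP => m; rewrite mcoeff_msupp mcoeff_deriv mulrn_eq0 /= => hm.
have /fd : mnm_add m (mnm1 i) \in msupp f by rewrite mcoeff_msupp.
by move=> h; have : mdeg (mnm_add m (mnm1 i)) = d.+1 := h; rewrite mdegD mdeg1 addn1 => -[].
Qed.

Lemma ddirn_homog k d f v :
  f \is ishomog1 (k + d) mdeg -> ddirn k v f \is ishomog1 d mdeg.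
Proof.
elim: k d f => [|k IH] d f fd //; rewrite /ddirn iterSr; apply: IH.
exact: ddir_homog.
Qed.

End LineRestriction.

Section Garding.
Variables (R : realType) (n d : nat) (p : mpoly n R) (e : 'rV[R]_n).
Hypothesis hp : hyperbolic d p e.
Local Notation C := R[i].
Local Notation toC := (real_complex R).
Implicit Types (v x y z : 'rV[R]_n).

Lemma hyperbolic_real_root y (w : C) :
  root (map_poly toC (on_line p y e)) w -> w \is Num.real.
Proof. by case: hp => _ _ h; rewrite -[y]opprK; exact: h. Qed.

Lemma hyperbolic_splits y : splits (on_line p y e).
Proof. by apply: real_rooted_splits => w; exact: hyperbolic_real_root. Qed.

Lemma hyperbolic_coef y : (on_line p y e)`_d = pval p e.
Proof. by case: hp => pd _ _; have [] := on_line_deg y e pd. Qed.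

Lemma hyperbolic_size y : size (on_line p y e) = d.+1.
Proof.
case: hp => pd p0 _; have [sp cp] := on_line_deg y e pd.
apply/eqP; rewrite eqn_leq sp ltnNge; apply/negP => /leq_sizeP/(_ d (leqnn d)).
by rewrite cp => p00; rewrite p00 ltxx in p0.
Qed.

Lemma hyperbolic_lead_gt0 y : 0 < lead_coef (on_line p y e).
Proof. by rewrite lead_coefE hyperbolic_size hyperbolic_coef; case: hp. Qed.

(** By homogeneity p(v + w x) = w^d p(x + s v), where s = 1 / w lies in the upper half plane;
    [root_free_homotopy] then moves the base point from x to i e. *)
Lemma garding_lower v x (w : C) :
  (forall t : R, root (on_line p v e) t -> t < 0) -> complex.Im w < 0 ->
  mmap toC (fun i => toC (v 0 i) + toC (x 0 i) * w) p != 0.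
Proof.
case: hp => pd p0 _ hv w0.
have toCi y : mmap toC (fun i => toC (y 0 i)) p = toC (pval p y).
  by rewrite /pval /meval rmorph_mmap.
have wN0 : w != 0 by apply: contraTneq w0 => ->; rewrite ltxx.
pose s := w^-1.
have s0 : 0 < complex.Im s.
  rewrite /s; case: (w) w0 => a b /= b0; rewrite -mulNr divr_gt0 ?oppr_gt0//.
  by rewrite ltr_wpDl ?sqr_ge0// exprn_even_gt0 //= lt_eqF.
have -> : mmap toC (fun i => toC (v 0 i) + toC (x 0 i) * w) p =
    w ^+ d * mmap toC (fun i => toC (x 0 i) + toC (v 0 i) * s) p.
  rewrite -(mmap_scale _ _ _ pd); apply: eq_mmap => // i.
  by rewrite mulrDr mulrCA /s mulfV// mulr1 addrC mulrC.
rewrite mulf_neq0 ?expf_neq0//.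
(* This makes L(s, c) = p(c i e + (1 - c) x + s v), the target being at c = 0. *)
pose a i : {poly C} := (toC (e 0 i) * 'i%C) *: 'X + toC (x 0 i) *: (1 - 'X).
pose b i : {poly C} := (toC (v 0 i))%:P.
pose L := mmap (polyC \o (polyC \o toC)) (fun i => (a i)%:P + b i *: 'X) p.
have [sL Ld] := @mmap_line_deg n R {poly C} (polyC \o toC) d p a b pd.
have LE (c r : C) : L.[r%:P].[c] =
    mmap toC (fun i => (toC (e 0 i) * 'i%C * c + toC (x 0 i) * (1 - c))
      + toC (v 0 i) * r) p.
  rewrite /L -[_.[r%:P]]/(horner_eval r%:P _) rmorph_mmap.
  rewrite -[LHS]/(horner_eval c _) rmorph_mmap.
  apply: eq_mmap => [t|i] /=; rewrite /horner_eval ?hornerC ?hornerC//.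
  by rewrite !hornerE.
have -> : mmap toC (fun i => toC (x 0 i) + toC (v 0 i) * s) p =
    L.[s%:P].[toC 0].
  rewrite LE; apply: eq_mmap => // i.
  by rewrite rmorph0 subr0 mulr0 mulr1 add0r.
have vN0 : pval p v != 0.
  apply/negP => /eqP v0; suff /hv : root (on_line p v e) 0 by rewrite ltxx.
  by apply/rootP; rewrite horner_on_line scale0r addr0.
apply: (root_free_homotopy sL (c := toC (pval p v))) => //.
- rewrite Ld -toCi -[RHS]/(polyC _) rmorph_mmap; exact: eq_mmap.
- by rewrite fmorph_eq0.
(* For real r, a zero would make the non-real number i c a root of p along [e] at the real point (1
   - c) x + r v. *)
- move=> c r c0 c1; rewrite LE; apply/negP => /eqP h.
  have : root (map_poly toC (on_line p ((1 - c) *: x + r *: v) e)) ('i%C * toC c).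
    apply/rootP; rewrite complex_on_line -h; apply: eq_mmap => // i.
    by rewrite !mxE !(rmorphD, rmorphM, rmorphB, rmorph1) /=; ring.
  move=> /hyperbolic_real_root; rewrite -[_ * _]/(Complex _ _) complex_real.
  by rewrite mul0r mul1r add0r gt_eqF.
move=> {}s {}s0; rewrite LE; apply/negP => /eqP h.
(* At c = 1, s = 0 gives i^d p(e); otherwise i / s is a root of p along [e] at [v], hence a negative
   real t, and s = i / t lies below the real axis. *)
have [sE|sN0] := eqVneq s 0.
  have : 'i%C ^+ d * toC (pval p e) == 0 :> C.
    rewrite -toCi -(mmap_scale _ _ _ pd) -h; apply/eqP; apply: eq_mmap => // i.
    by rewrite sE rmorph1 subrr !mulr0 mulr1 !addr0 mulrC.
  rewrite mulf_eq0 fmorph_eq0 (gt_eqF p0) orbF expf_eq0 => /andP[_].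
  by rewrite eq_complex /= oner_eq0 andbF.
have tr : root (map_poly toC (on_line p v e)) ('i%C / s).
  apply/rootP; rewrite complex_on_line.
  have : s ^+ d * mmap toC (fun i => toC (v 0 i) + toC (e 0 i) * ('i%C / s)) p = 0.
    rewrite -(mmap_scale _ _ _ pd) -h; apply: eq_mmap => // i.
    by rewrite rmorph1 subrr mulr0 mulr1 addr0; field.
  by move=> /eqP; rewrite mulf_eq0 expf_eq0 (negPf sN0) andbF => /eqP.
have /complex_realP [t ts] := hyperbolic_real_root tr.
move: tr; rewrite ts fmorph_root => /hv t0.
have : s = 'i%C / toC t.
  by rewrite -ts; field; rewrite sN0 eq_complex /= oner_eq0 andbF.
rewrite -fmorphV => sE; move: s0; rewrite sE /= mul0r mul1r add0r.
by rewrite invr_ge0 leNgt t0.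
Qed.

(** Applying [garding_lower] to (x, w) and to (- x, - w) excludes both open half planes. *)
Lemma garding v x :
  (forall t : R, root (on_line p v e) t -> t < 0) -> splits (on_line p v x).
Proof.
move=> hv; apply: real_rooted_splits => w; rewrite /root complex_on_line => wr.
have := garding_lower x (w := w) hv; have := garding_lower (- x) (w := - w) hv.
rewrite wr (eq_mmap (y2 := fun i => toC (v 0 i) + toC (x 0 i) * w) p (fun=> erefl)); last first.
  by move=> i; rewrite mxE rmorphN mulrNN.
rewrite wr; case: w {wr} => a b /= h1 h2; rewrite complex_real.
have [/h2//|b0|//] := ltrgtP b 0.
by have := h1; rewrite oppr_lt0 => /(_ b0).
Qed.

(** * Cone and multiplicity in terms of the coefficients along e *)

Lemma coef_ge0_horner_gt0 z (t : R) :
  (forall i, 0 <= (on_line p z e)`_i) -> 0 < t -> 0 < (on_line p z e).[t].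
Proof.
move=> zc t0; rewrite horner_coef hyperbolic_size big_ord_recr /= ltr_wpDl//.
  by apply: sumr_ge0 => i _; exact: mulr_ge0 (zc i) (exprn_ge0 i (ltW t0)).
by case: hp => _ p0 _; rewrite hyperbolic_coef mulr_gt0// exprn_gt0.
Qed.

(** A real-rooted polynomial with positive leading coefficient has no positive root exactly when its
    coefficients are nonnegative; the roots of t -> p(z + t e) are the negatives of those of t ->
    p(t e - z). *)
Lemma hyp_coneP z :
  hyp_cone p e z <-> forall i, 0 <= (on_line p z e)`_i.
Proof.
have [pd p0 _] := hp.
have rootN t : root (on_line p (- z) e) t = root (on_line p z e) (- t).
  rewrite /root !horner_on_line.
  have -> : - z + t *: e = - (z + - t *: e) by rewrite opprD scaleNr opprK.
  by rewrite (pval_opp _ pd) mulf_eq0 signr_eq0.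
split=> [zc|zc t].
  apply: (proj1 (splits_coef_ge0 (hyperbolic_splits z) (hyperbolic_lead_gt0 z) _)).
  by move=> t tr; rewrite -oppr_ge0; apply: zc; rewrite rootN opprK.
rewrite rootN leNgt => tr; apply/negP => t0; move: tr; apply/negP.
by rewrite /root gt_eqF// coef_ge0_horner_gt0// oppr_gt0.
Qed.

Lemma hyp_cone_shift_root z (t r : R) :
  hyp_cone p e z -> 0 < t -> root (on_line p (z + t *: e) e) r -> r < 0.
Proof.
move=> /hyp_coneP zc t0; rewrite /root horner_on_line -addrA -scalerDl => hr.
rewrite ltNge; apply/negP => r0; move: hr; apply/negP; rewrite -horner_on_line.
by rewrite gt_eqF// coef_ge0_horner_gt0// ltr_wpDr.
Qed.

Lemma cone_shift_splits z (t : R) x :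
  hyp_cone p e z -> 0 < t -> splits (on_line p (z + t *: e) x).
Proof. by move=> zc t0; apply: garding => r; exact: hyp_cone_shift_root. Qed.

Lemma coef_pos_propagates z i : hyp_cone p e z ->
  0 < pval (ddirn i e p) z -> (i < d)%N -> 0 < pval (ddirn i.+1 e p) z.
Proof.
move=> zc; rewrite -!coef_on_line_gt0 => hi id.
have [//|_] := splits_coef_ge0 (hyperbolic_splits z) (hyperbolic_lead_gt0 z) _.
  move=> t; rewrite leNgt; apply: contraL => t0.
  by have /hyp_coneP zc' := zc; rewrite /root gt_eqF// coef_ge0_horner_gt0.
by apply; rewrite ?hyperbolic_size.
Qed.

Lemma mult_ddirn z (m := mult p e z) :
  (forall i, (i < m)%N -> pval (ddirn i e p) z = 0) /\
  pval (ddirn m e p) z != 0.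
Proof.
have [pd p0 _] := hp.
(* [mult] looks at - z; as D_e^k p is homogeneous of degree d - k, passing to z changes each
   coefficient by a sign only. *)
have opp_eq0 k : ((on_line p (- z) e)`_k == 0) = (pval (ddirn k e p) z == 0).
  have [kd|kd] := leqP k d; last first.
    by rewrite -!coef_on_line_eq0 !nth_default ?hyperbolic_size.
  rewrite coef_on_line_eq0 (@pval_opp _ _ (d - k)) ?mulf_eq0 ?signr_eq0//.
  by apply: ddirn_homog; rewrite subnKC.
have P0 : on_line p (- z) e != 0 by rewrite -size_poly_gt0 hyperbolic_size.
have dvdX k : ('X^k %| on_line p (- z) e) = (k <= m)%N.
  by rewrite /m /mult mup_geq// subr0.
have low i : (i < m)%N -> (on_line p (- z) e)`_i = 0.
  by apply: dvdpXn_coef; rewrite dvdX.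
split=> [i /low/eqP|]; first by rewrite opp_eq0 => /eqP.
rewrite -opp_eq0; apply/negP => /eqP m0; have := ltnn m; rewrite -dvdX => /negP; apply.
by apply: dvdpXnP => i; rewrite ltnS leq_eqVlt => /predU1P[->//|/low].
Qed.

Lemma mult_le_deg z : (mult p e z <= d)%N.
Proof.
have [_ ] := mult_ddirn z; rewrite -coef_on_line_eq0 leqNgt => h; apply: contra h.
by move=> dm; rewrite nth_default// hyperbolic_size.
Qed.

End Garding.

Lemma ddir_hyperbolic (R : realType) n d (p : mpoly n R) (e : 'rV[R]_n) :
  hyperbolic d.+1 p e -> hyperbolic d (ddir e p) e.
Proof.
move=> hp; have [pd p0 _] := hp.
have dpd := ddir_homog e pd.
split=> // [|x w].
  have [_ <-] := on_line_deg 0 e dpd.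
  by rewrite on_line_ddir coef_deriv (hyperbolic_coef hp) pmulrn_lgt0.
rewrite on_line_ddir; apply: splits_deriv_real; first exact: hyperbolic_splits hp _.
by rewrite (hyperbolic_size hp).
Qed.

Lemma ddirn_hyperbolic (R : realType) n k d (p : mpoly n R) (e : 'rV[R]_n) :
  hyperbolic (k + d) p e -> hyperbolic d (ddirn k e p) e.
Proof.
elim: k d p => [//|k IH] d p hp; rewrite /ddirn iterSr; apply: IH.
exact: ddir_hyperbolic.
Qed.

(** By [hyp_coneP] it suffices that derivation shifts the coefficients and multiplies them by
    natural numbers. *)
Lemma ddirn_cone (R : realType) n k d (p : mpoly n R) (e z : 'rV[R]_n) :
  hyperbolic (k + d) p e -> hyp_cone p e z -> hyp_cone (ddirn k e p) e z.
Proof.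
move=> hp /(hyp_coneP hp) zc; apply/(hyp_coneP (ddirn_hyperbolic hp)) => i.
by rewrite on_line_ddirn coef_derivn mulrn_wge0.
Qed.

(** * Boundary points of the hyperbolicity cone *)

Section DirectionalCalculus.
Variables (R : realType) (n : nat).
Implicit Types (f g p : mpoly n R) (e u v x y z : 'rV[R]_n).

Lemma pvalD f g x : pval (f + g) x = pval f x + pval g x.
Proof. exact: mevalD. Qed.

Lemma pvalZ (c : R) f x : pval (c *: f) x = c * pval f x.
Proof. exact: mevalZ. Qed.

HB.instance Definition _ v :=
  GRing.isLinear.Build R (mpoly n R) (mpoly n R) *:%R (ddir v) (ddir_is_linear v).

Lemma ddirDl u v f : ddir (u + v) f = ddir u f + ddir v f.
Proof. by rewrite /ddir -big_split; apply: eq_bigr => i _; rewrite mxE scalerDl. Qed.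

Lemma ddirZl (c : R) v f : ddir (c *: v) f = c *: ddir v f.
Proof. by rewrite /ddir scaler_sumr; apply: eq_bigr => i _; rewrite mxE scalerA. Qed.

Lemma ddirC u v f : ddir u (ddir v f) = ddir v (ddir u f).
Proof.
rewrite [ddir u (ddir v f)]/ddir [in RHS]/(ddir u f) linear_sum.
by apply: eq_bigr => i _; rewrite mderiv_ddir linearZ.
Qed.

Lemma ddirn_ddir k u v f : ddirn k u (ddir v f) = ddir v (ddirn k u f).
Proof. by elim: k => [//|k IH]; rewrite /ddirn !iterS -!/(ddirn _ _ _) IH ddirC. Qed.

Lemma on_line_eq0P f x v : on_line f x v = 0 <-> forall k, pval (ddirn k v f) x = 0.
Proof.
split=> [h k|h]; first by apply/eqP; rewrite -coef_on_line_eq0 h coef0.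
by apply/polyP => k; apply/eqP; rewrite coef0 coef_on_line_eq0 h.
Qed.

(* Otherwise unification unfolds these when it compares values at different
   directions, which is very slow. *)
#[local] Opaque ddir pval on_line.

Lemma pval_ddir_comb (a b : R) u v f z :
  pval (ddir (a *: u + b *: v) f) z = a * pval (ddir u f) z + b * pval (ddir v f) z.
Proof. by rewrite ddirDl !ddirZl pvalD !pvalZ. Qed.

Lemma ddirn2_comb (a b : R) u v f z :
  pval (ddirn 2 (a *: u + b *: v) f) z = a ^+ 2 * pval (ddirn 2 u f) z
    + 2 * a * b * pval (ddir v (ddir u f)) z + b ^+ 2 * pval (ddirn 2 v f) z.
Proof.
rewrite /ddirn /=; set y := _ + _.
have E h : pval (ddir y h) z = a * pval (ddir u h) z + b * pval (ddir v h) z.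
  exact: pval_ddir_comb.
clearbody y; rewrite E (ddirC u y) (ddirC v y) !E (ddirC u v).
have aux (A B C : R) : a * (a * A + b * B) + b * (a * B + b * C) =
    a ^+ 2 * A + 2 * a * b * B + b ^+ 2 * C by ring.
exact: aux.
Qed.

Lemma ddirn3_comb (a b : R) u v f z :
  pval (ddirn 3 (a *: u + b *: v) f) z = a ^+ 3 * pval (ddirn 3 u f) z
    + 3 * a ^+ 2 * b * pval (ddir v (ddirn 2 u f)) z
    + 3 * a * b ^+ 2 * pval (ddirn 2 v (ddir u f)) z
    + b ^+ 3 * pval (ddirn 3 v f) z.
Proof.
set y := _ + _.
have e2 h w : pval (ddir w (ddirn 2 y h)) z = a ^+ 2 * pval (ddirn 2 u (ddir w h)) z
    + 2 * a * b * pval (ddir v (ddir u (ddir w h))) z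
    + b ^+ 2 * pval (ddirn 2 v (ddir w h)) z.
  by apply: etrans (ddirn2_comb _ _ _ _ _ _); rewrite ddirn_ddir.
apply: etrans (pval_ddir_comb _ _ _ _ _ _) _.
have eu := e2 f u; have ev := e2 f v.
have e1 : pval (ddirn 2 u (ddir v f)) z = pval (ddir v (ddirn 2 u f)) z.
  by rewrite ddirn_ddir.
have e3 : pval (ddir v (ddir u (ddir v f))) z = pval (ddirn 2 v (ddir u f)) z.
  by rewrite (ddirC u v).
have aux (A B C D B' C' U V : R) :
    U = a ^+ 2 * A + 2 * a * b * B + b ^+ 2 * C ->
    V = a ^+ 2 * B' + 2 * a * b * C' + b ^+ 2 * D -> B' = B -> C' = C ->
    a * U + b * V =
    a ^+ 3 * A + 3 * a ^+ 2 * b * B + 3 * a * b ^+ 2 * C + b ^+ 3 * D.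
  by move=> -> -> -> ->; ring.
exact: aux eu ev e1 e3.
Qed.

End DirectionalCalculus.


(** The arithmetic of [ddirn_vanish]: the common factor [s] cancels, and the factor [t] surviving on
    the right is the gain. *)
Lemma rescale_bound (R : realFieldType) (y a b c s t u v : R) :
  0 < s -> 0 < t -> 0 <= u -> u <= v ->
  y * (s * a) <= u * `|t * b| * (s * c) -> y * a <= t * (v * `|b * c|).
Proof.
move=> s0 t0 u0 uv h; rewrite -(ler_pM2l s0) [leLHS]mulrCA (le_trans h)//.
rewrite normrM (gtr0_norm t0) normrM.
rewrite [leLHS](_ : _ = s * t * `|b| * (u * c)); last by ring.
rewrite [leRHS](_ : _ = s * t * `|b| * (v * `|c|)); last by ring.
apply: ler_wpM2l; first by rewrite !mulr_ge0 ?(ltW s0) ?(ltW t0).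
apply: le_trans (_ : u * `|c| <= _); first by rewrite ler_wpM2l ?ler_norm.
by rewrite ler_wpM2r.
Qed.

(** In x + y the terms in [b] and [d] cancel, which leaves 2 l^3 a > 0. *)
Lemma cubic_sign_contra (R : realFieldType) (l a b c d x y : R) :
  0 < l ^+ 3 * a -> c = 0 ->
  x = l ^+ 3 * a + 3 * l ^+ 2 * 1 * b + 3 * l * 1 ^+ 2 * c + 1 ^+ 3 * d ->
  y = l ^+ 3 * a + 3 * l ^+ 2 * -1 * b + 3 * l * (-1) ^+ 2 * c + (-1) ^+ 3 * d ->
  x <= 0 -> y <= 0 -> False.
Proof. by move=> la0 -> -> ->; move: (l ^+ 3 * a) (l ^+ 2) la0 => u v; lra. Qed.

(** * Expansion of g(z + t e + s x) at a point z of the cone *)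

Section ConeBoundary.
Variables (R : realType) (n d : nat) (g : mpoly n R) (e z : 'rV[R]_n).
Hypotheses (hg : hyperbolic d g e) (zg : hyp_cone g e z).
Implicit Types x : 'rV[R]_n.

Let W k x := on_line (ddirn k x g) z e.

Lemma horner_ddirn_line k x (t : R) :
  (W k x).[t] = (on_line g (z + t *: e) x)`_k *+ k`!.
Proof. by rewrite /W horner_on_line -coef_on_line. Qed.

Lemma laguerre_ray x (t : R) : 0 < t ->
  (W 0 x).[t] * (W 2 x).[t] <= (W 1 x).[t] ^+ 2.
Proof.
move=> t0; have := splits_laguerre (cone_shift_splits hg x zg t0).
have f0 : 0`! = 1%N by [].
have f1 : 1`! = 1%N by [].
have f2 : 2`! = 2 by [].
rewrite !horner_ddirn_line f0 f1 f2 !mulr1n.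
move: (on_line _ _ _)`_0 (on_line _ _ _)`_1 (on_line _ _ _)`_2.
by move=> a b c; congr (_ <= _); ring.
Qed.

Lemma laguerre_ray_deriv x (t : R) : 0 < t ->
  (W 1 x).[t] * (W 3 x).[t] <= (W 2 x).[t] ^+ 2.
Proof.
move=> t0; have := splits_laguerre (splits_deriv (cone_shift_splits hg x zg t0)).
have f2 : 2`! = 2 by [].
have f3 : 3`! = 6 by [].
have f1 : 1`! = 1%N by [].
rewrite !horner_ddirn_line f1 f2 f3 !coef_deriv !mulr1n.
move: (on_line _ _ _)`_1 (on_line _ _ _)`_2 (on_line _ _ _)`_3.
by move=> a b c; congr (_ <= _); ring.
Qed.

Lemma coef0_ddirn_line k x : (W k x)`_0 = pval (ddirn k x g) z.
Proof. by rewrite -horner_coef0 /W horner_on_line scale0r addr0. Qed.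

Lemma coef1_ddirn_line k x : (W k x)`_1 = pval (ddir e (ddirn k x g)) z.
Proof. by rewrite -[RHS]/(pval (ddirn 1 e _) _) -coef_on_line mulr1n. Qed.

Lemma coef2_ddirn_line k x : (W k x)`_2 *+ 2 = pval (ddirn 2 e (ddirn k x g)) z.
Proof. by rewrite -coef_on_line. Qed.

(** With g and D_x g zero at z, Laguerre's inequality at z + t e reads D_e g(z) D_x^2 g(z) <= 0 to
    first order in t. *)
Lemma tangent_form_le0 x : pval g z = 0 -> 0 < pval (ddir e g) z ->
  pval (ddir x g) z = 0 -> pval (ddirn 2 x g) z <= 0.
Proof.
move=> g0 eg0 xg0; have := laguerre_at0 _ _ (laguerre_ray x).
rewrite coef1_ddirn_line !coef0_ddirn_line => /(_ g0 xg0).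
by rewrite pmulr_rle0.
Qed.

(** By [splits_coef_bound] the first three coefficients in s control the others: when they are, up
    to constants, t^k times A, B, D with A(0) nonzero, all are O(t^k) and vanish at t = 0. *)
Lemma ddirn_vanish k x : (0 < k)%N ->
  'X^k %| W 0 x -> (W 0 x)`_k != 0 -> 'X^k %| W 1 x -> 'X^k %| W 2 x ->
  on_line g z x = 0.
Proof.
move=> k0 /dvdpP [A WA] Wk /dvdpP [B WB] /dvdpP [D WD].
have A0 : A`_0 != 0 by move: Wk; rewrite WA coefMXn ltnn subnn.
apply/on_line_eq0P => j; rewrite -coef0_ddirn_line; apply: dvdpXn_coef k0.
(* As A(0) is nonzero, divisibility by X^k can be tested after multiplication by A^(2j). *)
have cop : coprimep 'X^k (A ^+ (2 * j)).
  apply/coprimep_expl/coprimep_expr; rewrite coprimep_sym coprimepX /root.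
  by rewrite horner_coef0.
rewrite -(Gauss_dvdpl _ cop).
(* The right side of [splits_coef_bound] without its powers of t^k; d + 1 bounds the size of every
   line restriction, and j! relates the coefficient of s^j to [W j x]. *)
pose Q := (2 ^+ d.+1 *+ j`!) *: (A * (A ^+ 2 + (B ^+ 2 - A * D)) ^+ j).
apply: (@dvdpXn_le _ _ Q) => t t0; have := cone_shift_splits hg x zg t0.
set h := on_line g (z + t *: e) x => hs.
have h0E : h`_0 = t ^+ k * A.[t].
  by have := horner_ddirn_line 0 x t; rewrite WA !(hornerM, hornerXn) mulr1n mulrC.
have h1E : h`_1 = t ^+ k * B.[t].
  by have := horner_ddirn_line 1 x t; rewrite WB !(hornerM, hornerXn) mulr1n mulrC.
have h2E : h`_2 *+ 2 = t ^+ k * D.[t].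
  by have := horner_ddirn_line 2 x t; rewrite WD !(hornerM, hornerXn) mulrC.
have h0 : h`_0 != 0.
  rewrite gt_eqF//; have := horner_ddirn_line 0 x t; rewrite mulr1n => <-.
  by apply: (coef_ge0_horner_gt0 hg) => //; apply/(hyp_coneP hg).
have tk : 0 < t ^+ k by rewrite exprn_gt0.
have sh : 2 ^+ size h <= 2 ^+ d.+1 :> R.
  rewrite ler_weXn2l ?ler1n//.
  by case: hg => gd _ _; case: (on_line_deg (z + t *: e) x gd).
have := splits_coef_bound j hs h0; rewrite -[2 * _ * _]mulrA mulr_natl -mulrnAr h2E h0E h1E.
rewrite hornerM horner_ddirn_line -/h horner_exp.
rewrite /Q hornerZ !(hornerD, hornerN, horner_exp, hornerM).
move: (h`_j) (A.[t]) (B.[t]) (D.[t]) => y a b c.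
move: (t ^+ k) tk => T tk; set s := a ^+ 2 + (b ^+ 2 - a * c).
rewrite (_ : (T * a) ^+ 2 + _ = T ^+ 2 * s); last by rewrite /s; ring.
rewrite [(T * a) ^+ (2 * j)]exprMn [(T ^+ 2 * s) ^+ j]exprMn -exprM; clearbody s => H.
have key : `|y| * a ^+ (2 * j) <= T * (2 ^+ d.+1 * `|a * s ^+ j|).
  exact: rescale_bound (exprn_gt0 (2 * j) tk) tk (exprn_ge0 _ (ler0n _ 2)) sh H.
rewrite normrM normrMn [`|a ^+ _|]ger0_norm; last first.
  by rewrite exprM exprn_ge0// sqr_ge0.
rewrite normrM normrMn [`|2 ^+ _|]ger0_norm ?exprn_ge0//.
by rewrite !mulrnAl mulrnAr lerMn2r key orbT.
Qed.

Lemma tangent_vanish_mult1 x : pval g z = 0 -> 0 < pval (ddir e g) z ->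
  pval (ddir x g) z = 0 -> pval (ddirn 2 x g) z = 0 -> on_line g z x = 0.
Proof.
move=> g0 eg0 xg0 xxg0; apply: (@ddirn_vanish 1) => //.
- by apply: dvdpXnP => -[|]; rewrite ?coef0_ddirn_line.
- by rewrite coef1_ddirn_line gt_eqF.
- by apply: dvdpXnP => -[|]; rewrite ?coef0_ddirn_line.
- by apply: dvdpXnP => -[|]; rewrite ?coef0_ddirn_line.
Qed.

(** Laguerre's inequality is taken in direction [e] at the points z + t y: to first order in t it
    gives D_y g(z) D_e^2 g(z) <= 0, for y and for - y. *)
Lemma ddir_vanish_mult2 x : pval g z = 0 -> pval (ddir e g) z = 0 ->
  0 < pval (ddirn 2 e g) z -> pval (ddir x g) z = 0.
Proof.
move=> g0 eg0 eeg0.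
have le0 y : pval (ddir y g) z <= 0.
  pose V k := on_line (ddirn k e g) z y.
  have V0 k : (V k)`_0 = pval (ddirn k e g) z.
    by rewrite -horner_coef0 /V horner_on_line scale0r addr0.
  have := @laguerre_at0 _ (V 0) (V 1) (V 2).
  rewrite !V0 => /(_ g0 eg0); rewrite -[(V 0)`_1]mulr1n coef_on_line.
  rewrite pmulr_lle0//; apply => t t0.
  have Vt k : (V k).[t] = (on_line g (z + t *: y) e)`_k *+ k`!.
    by rewrite /V horner_on_line -coef_on_line.
  have := splits_laguerre (hyperbolic_splits hg (z + t *: y)).
  have -> : (V 2).[t] = (on_line g (z + t *: y) e)`_2 *+ 2 := Vt 2.
  rewrite !Vt; move: (on_line _ _ _)`_0 (on_line _ _ _)`_1 (on_line _ _ _)`_2.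
  by move=> a b c; rewrite !mulr1n; lra.
apply/le_anti; rewrite le0 /= -oppr_le0.
by have := le0 (- x); rewrite -scaleN1r ddirZl pvalZ mulN1r.
Qed.

(* When lam ^ 2 D_e^2 g(z) = - c ^ 2 D_x^2 g(z) the direction y = lam e + c x is
   a zero of the quadratic part of g at z, so that
   D_y g(z + t e) D_y^3 g(z + t e) <= (D_y^2 g(z + t e)) ^ 2 = O(t ^ 2). *)
Lemma cubic_form_le0 x (lam c : R) : 0 < lam ->
  pval g z = 0 -> pval (ddir e g) z = 0 -> 0 < pval (ddirn 2 e g) z ->
  pval (ddir x (ddir e g)) z = 0 ->
  lam ^+ 2 * pval (ddirn 2 e g) z + c ^+ 2 * pval (ddirn 2 x g) z = 0 ->
  pval (ddirn 3 (lam *: e + c *: x) g) z <= 0.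
Proof.
move=> lam0 g0 eg0 eeg0 xeg0 lamE; set y := _ + _.
have D1 : pval (ddirn 1 y g) z = 0 by exact: ddir_vanish_mult2.
have D2 : pval (ddirn 2 y g) z = 0.
  by rewrite ddirn2_comb xeg0 mulr0 addr0.
have De : pval (ddir e (ddirn 1 y g)) z = lam * pval (ddirn 2 e g) z.
  rewrite -[ddirn 1 y g]/(ddir y g) ddirC pval_ddir_comb xeg0 mulr0 addr0.
  by [].
have := laguerre_at0 _ _ (laguerre_ray_deriv y).
rewrite coef1_ddirn_line De !coef0_ddirn_line => /(_ D1 D2).
by rewrite pmulr_rle0// mulr_gt0.
Qed.

Lemma ddirn2_vanish_mult2 x : pval g z = 0 -> pval (ddir e g) z = 0 ->
  0 < pval (ddirn 2 e g) z -> 0 < pval (ddirn 3 e g) z ->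
  pval (ddir x (ddir e g)) z = 0 -> pval (ddirn 2 x (ddir e g)) z = 0 ->
  pval (ddirn 2 x g) z = 0.
Proof.
move=> g0 eg0 eeg0 eeeg0 xeg0 xxeg0; apply/le_anti/andP; split.
  (* As t -> g(z + t e) has a double zero, order t^2 of Laguerre's inequality bounds D_e^2 g(z)
     D_x^2 g(z) by a multiple of (D_e D_x g(z))^2 = 0. *)
  have := laguerre_at0_double _ _ _ (laguerre_ray x).
  rewrite !coef0_ddirn_line !coef1_ddirn_line => /(_ g0 eg0).
  rewrite ddirC xeg0 expr0n => /(_ (ddir_vanish_mult2 x g0 eg0 eeg0)) /=.
  by rewrite -(ler_pMn2r (n := 2))// -mulrnAl coef2_ddirn_line mul0rn pmulr_rle0.
rewrite leNgt; apply/negP => xxg0.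
(* Chosen so that lam e + x and lam e - x are zeros of the quadratic part; their cubic forms sum to
   2 lam^3 D_e^3 g(z) > 0, against [cubic_form_le0]. *)
pose a := - pval (ddirn 2 x g) z / pval (ddirn 2 e g) z.
have a0 : 0 < a by rewrite divr_gt0// oppr_gt0.
pose lam := Num.sqrt a; have lam0 : 0 < lam by rewrite sqrtr_gt0.
have lamE : lam ^+ 2 * pval (ddirn 2 e g) z + pval (ddirn 2 x g) z = 0.
  by rewrite sqr_sqrtr ?(ltW a0)// /a divfK ?gt_eqF// addNr.
have h1 : pval (ddirn 3 (lam *: e + 1 *: x) g) z <= 0.
  by apply: cubic_form_le0 => //; rewrite expr1n mul1r.
have h2 : pval (ddirn 3 (lam *: e + -1 *: x) g) z <= 0.
  by apply: cubic_form_le0 => //; rewrite sqrrN expr1n mul1r.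
have lA := mulr_gt0 (exprn_gt0 3 lam0) eeeg0.
exact: cubic_sign_contra lA xxeg0 (ddirn3_comb _ _ _ _ _ _) (ddirn3_comb _ _ _ _ _ _) h1 h2.
Qed.

Lemma tangent_vanish_mult2 x : pval g z = 0 -> pval (ddir e g) z = 0 ->
  0 < pval (ddirn 2 e g) z -> 0 < pval (ddirn 3 e g) z ->
  on_line (ddir e g) z x = 0 -> on_line g z x = 0.
Proof.
move=> g0 eg0 eeg0 eeeg0 /on_line_eq0P xeg.
have xeg0 : pval (ddir x (ddir e g)) z = 0 := xeg 1%N.
apply: (@ddirn_vanish 2) => //.
- by apply: dvdpXnP => -[|[|]]; rewrite ?coef0_ddirn_line ?coef1_ddirn_line.
- have := coef2_ddirn_line 0 x; apply: contra_eqN => /eqP ->.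
  by rewrite mul0rn lt_eqF.
- apply: dvdpXnP => -[|[|]]; rewrite ?coef0_ddirn_line ?coef1_ddirn_line//.
    by move=> _; exact: ddir_vanish_mult2.
  by rewrite ddirC.
- apply: dvdpXnP => -[|[|]]; rewrite ?coef0_ddirn_line ?coef1_ddirn_line//.
    by move=> _; apply: ddirn2_vanish_mult2 => //; exact: xeg 2%N.
  by rewrite -ddirn_ddir (xeg 2%N).
Qed.

(** At every point of the line, the expansion of g along [e] lacks degrees 1 and 2, so
    [splits_laguerre_strict] annihilates its constant term. *)
Lemma line_vanish_descends x : (0 < d)%N ->
  on_line (ddir e g) z x = 0 -> on_line (ddirn 2 e g) z x = 0 ->
  on_line g z x = 0.
Proof.
move=> d0 h1 h2; apply: horner_eq0 => s.
rewrite horner_on_line -[pval _ _]/(pval (ddirn 0 e g) _) -coef_on_line mulr1n.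
apply: (splits_laguerre_strict (hyperbolic_splits hg _)).
- by rewrite (hyperbolic_size hg) ltnS.
- apply/eqP; rewrite coef_on_line_eq0 -horner_on_line.
  by rewrite -[ddirn 1 e g]/(ddir e g) h1 horner0.
- by apply/eqP; rewrite coef_on_line_eq0 -horner_on_line h2 horner0.
Qed.

End ConeBoundary.

(** * The kernel of the tangent Hessian *)

Lemma local_min_coef (R : rcfType) (P : {poly R}) (x : R) : 0 < x ->
  (forall t, `|t| < x -> 0 <= P.[t]) -> P`_0 = 0 -> P`_1 = 0 /\ 0 <= P`_2.
Proof.
move=> x0 Pge P0; have [Q PQ QE] := factorX P0.
have QN (e : R) : `|e| = 1 -> e * Q`_0 <= 0.
  move=> e1; rewrite leNgt -coefZ; apply/negP => /horner_gt0_near0 [y y0 yQ].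
  pose t := Num.min x y / 2.
  have xy : 0 < Num.min x y by rewrite lt_min x0.
  have t0 : 0 < t by rewrite divr_gt0.
  have tx : t < Num.min x y by rewrite /t ltr_pdivrMr// ltr_pMr// ltr1n.
  have e2 : e * e = 1 by rewrite -expr2 -real_normK ?num_real// e1 expr1n.
  have te : `|- e * t| = t by rewrite mulNr normrN normrM e1 mul1r gtr0_norm.
  have tyx : (t < x) && (t < y) by rewrite -lt_min.
  have [tx' ty] := andP tyx.
  have := yQ (- e * t); rewrite te => /(_ ty); rewrite hornerZ => h1.
  have := Pge (- e * t); rewrite te => /(_ tx'); rewrite PQ hornerM hornerX.
  rewrite (_ : _ * _ = - (t * (e * Q.[- e * t]))); last by ring.
  by rewrite oppr_ge0 leNgt mulr_gt0.
have Q0 : Q`_0 = 0.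
  apply/le_anti; have := QN 1; rewrite normr1 mul1r => -> //=.
  by have := QN (-1); rewrite normrN1 mulN1r oppr_le0 => ->.
split; first by rewrite -QE.
rewrite -QE; have [U QU UE] := factorX Q0; rewrite -UE.
rewrite leNgt -oppr_gt0 -coefN; apply/negP => /horner_gt0_near0 [y y0 yU].
pose t := Num.min x y / 2.
have xy : 0 < Num.min x y by rewrite lt_min x0.
have t0 : 0 < t by rewrite divr_gt0.
have tx : t < Num.min x y by rewrite /t ltr_pdivrMr// ltr_pMr// ltr1n.
have /andP[tx' ty] : (t < x) && (t < y) by rewrite -lt_min.
have := yU t; rewrite gtr0_norm// => /(_ ty); rewrite hornerN oppr_gt0 => h1.
have := Pge t; rewrite gtr0_norm// => /(_ tx').
by rewrite PQ QU !hornerM !hornerX leNgt !pmulr_llt0 ?h1.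
Qed.


Section Kernel.
Variables (R : realType) (n : nat) (q : mpoly n R) (z : 'rV[R]_n).
Implicit Types x y u v : 'rV[R]_n.

Definition tangent_kernel : set 'rV[R]_n :=
  [set x | tangent q z x /\ x *m tangent_hess q z = 0].

Lemma tangent_kernel0 : tangent_kernel 0.
Proof. by split; [apply/tangentE|]; rewrite mul0mx. Qed.

Lemma tangent_kernel_lin (a : R) x y :
  tangent_kernel x -> tangent_kernel y -> tangent_kernel (a *: x + y).
Proof.
move=> [/tangentE Tx Hx] [/tangentE Ty Hy]; split; first apply/tangentE.
  by rewrite mulmxDl -scalemxAl Tx Ty scaler0 addr0.
by rewrite mulmxDl -scalemxAl Hx Hy scaler0 addr0.
Qed.

Lemma tangent_kernel_span x (s : seq 'rV[R]_n) :
  (forall v, v \in s -> tangent_kernel v) -> x \in <<s>>%VS -> tangent_kernel x.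
Proof.
move=> sK xs; rewrite (coord_span (X := in_tuple s) xs).
apply: (big_ind tangent_kernel); first exact: tangent_kernel0.
  by move=> u v Ku Kv; rewrite -[u]scale1r; exact: tangent_kernel_lin.
move=> i _; rewrite -[_ *: _]addr0; apply: tangent_kernel_lin tangent_kernel0.
by apply: sK; rewrite mem_nth.
Qed.

(** With y = x H, the form at x + r y is 2 r |y|^2 + r^2 K <= 0; dividing by r > 0 and letting r
    tend to 0 gives y = 0. *)
Lemma tangent_kernel_isotropic x :
  (forall y, tangent q z y -> pval (ddirn 2 y q) z <= 0) ->
  tangent q z x -> pval (ddirn 2 x q) z = 0 -> tangent_kernel x.
Proof.
move=> nsd Tx xx0; split=> //; have [HT Hsym Hform] := tangent_hess_spec q z.
set H := tangent_hess q z in HT Hsym Hform *; pose y := x *m H.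
have Ty : tangent q z y := HT _ Tx.
pose N := (y *m y^T) 0 0; pose K := (y *m H *m y^T) 0 0.
have trl (r : R) : (x + r *: y)^T = x^T + r *: y^T by rewrite raddfD /= linearZ.
have E (r : R) : (x + r *: y) *m H *m (x + r *: y)^T =
    x *m H *m x^T + r *: (x *m H *m y^T) + r *: (y *m H *m x^T)
    + r ^+ 2 *: (y *m H *m y^T).
  rewrite trl !mulmxDl !mulmxDr -!scalemxAr -!scalemxAl scalerA expr2.
  by rewrite addrA.
have Hyx : y *m H *m x^T = y *m y^T by rewrite Hsym.
have xHx : (x *m H *m x^T) 0 0 = 0 by rewrite Hform.
have key (r : R) : 2 * r * N + r ^+ 2 * K <= 0.
  have Txy : tangent q z (x + r *: y).
    apply/tangentE; move: Tx Ty => /tangentE hx /tangentE hy.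
    by rewrite mulmxDl -scalemxAl hx hy scaler0 addr0.
  have entD (A B : 'M[R]_1) : (A + B) 0 0 = A 0 0 + B 0 0 by rewrite mxE.
  have entZ c (A : 'M[R]_1) : (c *: A) 0 0 = c * A 0 0 by rewrite mxE.
  have := nsd _ Txy; rewrite -Hform// E Hyx !entD !entZ xHx add0r -/N -/K.
  by congr (_ <= 0); ring.
apply/mulmx_tr_eq0/le_anti; rewrite -/y -/N andbC; apply/andP; split.
  by rewrite /N mxE; apply: sumr_ge0 => i _; rewrite [y^T _ _]mxE -expr2 sqr_ge0.
have : 0 <= (- (2 * N)%:P - K *: 'X)`_0.
  apply: horner_ge0_at0 => t t0; rewrite !(hornerD, hornerN, hornerZ, hornerC, hornerX).
  rewrite -(pmulr_rge0 _ t0) -oppr_le0; have := key t.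
  by congr (_ <= 0); ring.
by rewrite coefB coefN coefC coefZ coefX /= mulr0 subr0; lra.
Qed.

(** The minimum makes the first derivative along [u] zero and the second nonnegative, while
    [tangent_form_le0] makes the second nonpositive. *)
Lemma tangent_kernel_of_local_min d (e : 'rV[R]_n) u (r : R) :
  hyperbolic d q e -> hyp_cone q e z ->
  pval q z = 0 -> 0 < pval (ddir e q) z -> 0 < r ->
  (forall t, `|t| < r -> 0 <= pval q (z + t *: u)) -> tangent_kernel u.
Proof.
move=> hq zq q0 eq0 r0 qge.
have P0 : (on_line q z u)`_0 = 0 by rewrite -horner_coef0 horner_on_line scale0r addr0.
have [|P1 P2] := local_min_coef r0 _ P0.
  by move=> t tr; rewrite horner_on_line; exact: qge.
have Tu : tangent q z u.
  by rewrite /tangent /= -[pval _ _]/(pval (ddirn 1 u q) z) -coef_on_line P1.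
have nsd y : tangent q z y -> pval (ddirn 2 y q) z <= 0.
  exact: tangent_form_le0 hq zq _ q0 eq0.
apply: tangent_kernel_isotropic => //; apply/le_anti.
by rewrite nsd// -coef_on_line_ge0.
Qed.

End Kernel.

Lemma nbhs_line (R : realType) n (A : set 'rV[R]_n) (z u : 'rV[R]_n) :
  nbhs z A -> exists2 r : R, 0 < r & forall t : R, `|t| < r -> A (z + t *: u).
Proof.
move=> /nbhs_ballP [x /= x0 xA].
pose M := 1 + \sum_j `|u 0 j|.
have M0 : 0 < M by rewrite ltr_pwDl// sumr_ge0.
exists (x / M) => [|t tx]; first by rewrite divr_gt0.
apply: xA; split=> // i j; rewrite ord1 /ball /= !mxE opprD addNKr normrN normrM.
have uM : `|u 0 j| <= M.
  by rewrite /M (bigD1 j)//= addrCA lerDl addr_ge0// sumr_ge0.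
apply: le_lt_trans (ler_wpM2l (normr_ge0 t) uM) _.
by rewrite -ltr_pdivlMr.
Qed.

(** * The span of a face *)

Section Span.
Variables (R : realType) (n d : nat) (p : mpoly n R) (e z : 'rV[R]_n).
Hypotheses (hp : hyperbolic d p e) (zp : hyp_cone p e z).
Hypothesis m_gt0 : (0 < mult p e z)%N.
Local Notation m := (mult p e z).
Local Notation q := (ddirn m.-1 e p).
Implicit Types x y u v : 'rV[R]_n.

Lemma ddirn_mult_gt0 i : (m <= i <= d)%N -> 0 < pval (ddirn i e p) z.
Proof.
move=> /andP[]; elim: i => [|i IH]; first by rewrite leqNgt m_gt0.
rewrite leq_eqVlt => /predU1P[<- _|mi id].
  rewrite lt_neqAle eq_sym (proj2 (mult_ddirn hp z)) /=.
  by have /(hyp_coneP hp) zc := zp; rewrite -coef_on_line_ge0.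
by apply: (coef_pos_propagates hp zp) => //; apply: IH => //; exact: ltnW.
Qed.

Lemma ddirn_mult_eq0 i : (i < m)%N -> pval (ddirn i e p) z = 0.
Proof. by move=> im; exact: (proj1 (mult_ddirn hp z)). Qed.

Lemma hyperbolic_ddirn_le k : (k <= d)%N -> hyperbolic (d - k) (ddirn k e p) e.
Proof. by move=> kd; apply: ddirn_hyperbolic; rewrite subnKC. Qed.

Lemma ddirn_cone_le k x : (k <= d)%N -> hyp_cone p e x -> hyp_cone (ddirn k e p) e x.
Proof. by move=> kd; apply: (@ddirn_cone _ _ _ (d - k)); rewrite subnKC. Qed.

Lemma predm_le_deg : (m.-1 <= d)%N.
Proof. by apply: leq_trans (leq_pred _) _; exact: mult_le_deg hp z. Qed.

Lemma ddirnE k j : ddirn j e (ddirn k e p) = ddirn (j + k) e p.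
Proof. by rewrite /ddirn iterD. Qed.

Lemma q_at_z : pval q z = 0 /\ 0 < pval (ddir e q) z.
Proof.
split; first by apply: ddirn_mult_eq0; rewrite prednK.
rewrite -[ddir e q]/(ddirn m.-1.+1 e p) prednK//.
by apply: ddirn_mult_gt0; rewrite leqnn mult_le_deg.
Qed.

Lemma face_subset_kernel (F : set 'rV[R]_n) v :
  F `<=` hyp_cone p e -> rel_interior F z -> F v -> tangent_kernel q z v.
Proof.
move=> Fp [Fz relz] Fv; have [q0 eq0] := q_at_z.
have hq := hyperbolic_ddirn_le predm_le_deg.
have zq := ddirn_cone_le predm_le_deg zp.
have qge y : hyp_cone p e y -> 0 <= pval q y.
  by move=> /(hyp_coneP hp) yc; rewrite -coef_on_line_ge0.
(* By homogeneity q vanishes on the whole line through z and the origin. *)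
have Kz : tangent_kernel q z z.
  apply: (tangent_kernel_of_local_min hq zq q0 eq0 ltr01) => t _.
  case: hq => qd _ _; rewrite -[X in X + _]scale1r -scalerDl (pval_scale _ _ qd).
  by rewrite q0 mulr0.
have [r r0 rF] := nbhs_line (v - z) relz.
suff Kvz : tangent_kernel q z (v - z).
  by rewrite -[v](subrK z) -[_ - z]scale1r; exact: tangent_kernel_lin.
apply: (tangent_kernel_of_local_min hq zq q0 eq0 r0) => t tr.
apply/qge/Fp/(rF _ tr).
(* The point z + t (v - z) is the affine combination (1 - t) z + t v, for t of either sign. *)
exists 2%N, (fun i : 'I_2 => if i == ord0 then z else v),
  (fun i : 'I_2 => if i == ord0 then 1 - t else t); split.
- by move=> i; case: ifP.
- by rewrite !big_ord_recl big_ord0 /= addr0 subrK.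
rewrite !big_ord_recl big_ord0 /= addr0 scalerBr scalerBl scale1r.
by rewrite addrA addrAC.
Qed.

Lemma vanish_of_kernel x : (m < d)%N -> tangent_kernel q z x ->
  forall k, (k < m)%N -> on_line (ddirn k e p) z x = 0.
Proof.
move=> md [Tx Hx].
have xxq0 : pval (ddirn 2 x q) z = 0.
  have [_ _ <-] := tangent_hess_spec q z; last exact: Tx.
  by rewrite Hx mul0mx mxE.
have [q0 eq0] := q_at_z.
(* Downward induction from k = m - 1 with j = m - 1 - k: j = 0 is the case of multiplicity one, j =
   1 that of multiplicity two, and larger j use the two preceding ones. *)
suff vanish j : (j < m)%N -> on_line (ddirn (m.-1 - j) e p) z x = 0.
  move=> k km; have := vanish (m.-1 - k)%N; rewrite subKn; last by rewrite -ltnS prednK.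
  by apply; rewrite -[X in (_ < X)%N](prednK m_gt0) ltnS leq_subr.
have [l] := ubnP j; elim: l j => // l IH [|[|j]] jl jm.
- rewrite subn0.
  have hq := hyperbolic_ddirn_le predm_le_deg.
  exact: tangent_vanish_mult1 hq (ddirn_cone_le predm_le_deg zp) _ q0 eq0 Tx xxq0.
- have E1 : m.-1 = (m.-1 - 1).+1 by lia.
  have kd : (m.-1 - 1 <= d)%N by lia.
  apply: (tangent_vanish_mult2 (hyperbolic_ddirn_le kd) (ddirn_cone_le kd zp)).
  + by apply: ddirn_mult_eq0; lia.
  + by rewrite -[ddir e _]/(ddirn 1 e _) ddirnE; apply: ddirn_mult_eq0; lia.
  + by rewrite ddirnE; apply: ddirn_mult_gt0; lia.
  (* The derivative of order m + 1, positive because m < d. *)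
  + by rewrite ddirnE; apply: ddirn_mult_gt0; lia.
  + have := IH 0%N; rewrite subn0 -[ddir e _]/(ddirn 1 e _) ddirnE.
    by rewrite (_ : (1 + (m.-1 - 1))%N = m.-1); [apply; lia|lia].
have kd : (m.-1 - j.+2 <= d)%N by lia.
apply: (line_vanish_descends (hyperbolic_ddirn_le kd)); first by lia.
  have := IH j.+1; rewrite -[ddir e _]/(ddirn 1 e _) ddirnE.
  by rewrite (_ : (1 + (m.-1 - j.+2))%N = (m.-1 - j.+1)%N); [apply; lia|lia].
have := IH j; rewrite ddirnE.
by rewrite (_ : (2 + (m.-1 - j.+2))%N = (m.-1 - j)%N); [apply; lia|lia].
Qed.

Lemma vanish_of_tangent_power x : linear_form_power d p -> tangent q z x ->
  forall k, (k < m)%N -> on_line (ddirn k e p) z x = 0.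
Proof.
move=> [c [l pE]] Tx; pose lf y := (y *m l^T) 0 0.
have lfD (a : R) y y' : lf (a *: y + y') = a * lf y + lf y'.
  rewrite /lf mulmxDl -scalemxAl; move: (y *m _) (y' *m _) => A B.
  by rewrite !mxE.
have d0 : (0 < d)%N by apply: leq_trans m_gt0 (mult_le_deg hp z).
have le0 : lf e != 0.
  case: hp => _ pe _; apply: contraTneq pe => le0.
  by rewrite pE -/(lf e) le0 expr0n gtn_eqF// mulr0 ltxx.
(* Moving z along ker l leaves p unchanged on the lines of direction e, hence all D_e^k p. *)
have const y : lf y = 0 -> forall k,
    on_line (ddirn k e p) z y = (pval (ddirn k e p) z)%:P.
  move=> ly k; apply/eqP; rewrite -subr_eq0; apply/eqP/horner_eq0 => s.
  rewrite hornerD hornerN hornerC horner_on_line.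
  suff E : on_line p (z + s *: y) e = on_line p z e.
    by rewrite -!coef_on_line E subrr.
  apply/eqP; rewrite -subr_eq0; apply/eqP/horner_eq0 => t.
  rewrite hornerD hornerN !horner_on_line !pE.
  rewrite -!/(lf _) [z + _ + _]addrC ![_ + t *: e]addrC !lfD [z + _]addrC lfD ly.
  by rewrite mulr0 add0r subrr.
have [q0 eq0] := q_at_z.
have lx : lf x = 0.
  (* Subtracting a e from x lands in ker l, where q has zero derivative; as D_x q(z) = 0 < D_e q(z),
     a is zero. *)
  pose a := lf x / lf e.
  have ly : lf (- a *: e + x) = 0 by rewrite lfD mulNr divfK// addNr.
  have : pval (ddir (- a *: e + x) q) z = 0.
    by rewrite -[ddir _ _]/(ddirn 1 _ _) -coef_on_line const// coefC.
  rewrite ddirDl ddirZl pvalD pvalZ (Tx : pval (ddir x q) z = 0) addr0.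
  move=> /eqP; rewrite mulf_eq0 (gt_eqF eq0) orbF oppr_eq0 mulf_eq0 invr_eq0.
  by rewrite (negPf le0) orbF => /eqP.
by move=> k km; rewrite const// ddirn_mult_eq0.
Qed.

Lemma cone_of_vanish x :
  (forall k, (k < m)%N -> on_line (ddirn k e p) z x = 0) ->
  exists2 r : R, 0 < r & forall t, `|t| < r -> hyp_cone p e (z + t *: x).
Proof.
move=> van.
have [r r0 rP] : exists2 r : R, 0 < r & forall (t : R) i, `|t| < r -> (i < d.+1)%N ->
    0 <= pval (ddirn i e p) (z + t *: x).
  have: (d.+1 <= d.+1)%N by [].
  (* Induction on the number of indices treated: below m the value is zero on the whole line, from m
     on it is positive at z, hence nearby. *)
  elim: {1 3}d.+1 => [|N IH] Nd; first by exists 1.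
  have [r r0 rP] := IH (ltnW Nd).
  have [Nm|mN] := ltnP N m.
    exists r => // t i tr; rewrite ltnS leq_eqVlt => /predU1P[->|]; last exact: rP.
    by rewrite -horner_on_line van// horner0.
  have : 0 < (on_line (ddirn N e p) z x)`_0.
    by rewrite -horner_coef0 horner_on_line scale0r addr0 ddirn_mult_gt0// mN.
  move=> /horner_gt0_near0 [s s0 sP].
  exists (Num.min r s) => [|t i]; first by rewrite lt_min r0.
  rewrite lt_min => /andP[tr ts]; rewrite ltnS leq_eqVlt => /predU1P[->|]; last exact: rP.
  by rewrite -horner_on_line ltW// sP.
exists r => // t tr; apply/(hyp_coneP hp) => i.
have [id|id] := ltnP i d.+1; first by rewrite coef_on_line_ge0 rP.
by rewrite nth_default// (hyperbolic_size hp).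
Qed.

(** The point z is the midpoint of z + s x and z - s x, which lie in the cone for small s, so the
    face property puts them in [F]. *)
Lemma span_of_vanish (F : set 'rV[R]_n) x : face (hyp_cone p e) F -> F z ->
  (forall k, (k < m)%N -> on_line (ddirn k e p) z x = 0) -> lin_span F x.
Proof.
move=> [_ _ _ Fface] Fz /cone_of_vanish [r r0 rC].
pose s := r / 2.
have s0 : 0 < s by rewrite divr_gt0.
have sr : s < r by rewrite /s ltr_pdivrMr// ltr_pMr// ltr1n.
have Cp : hyp_cone p e (z + s *: x) by apply: rC; rewrite gtr0_norm.
have Cm : hyp_cone p e (z + - s *: x) by apply: rC; rewrite normrN gtr0_norm.
have [|||Fp _] := Fface _ _ (1 / 2) Cp Cm.
- by rewrite divr_gt0.
- by rewrite ltr_pdivrMr// mul1r ltr1n.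
- rewrite (_ : 1 - 1 / 2 = 1 / 2 :> R); last by field.
  rewrite -scalerDr scaleNr addrACA subrr addr0 -(mulr2n z) -(scaler_nat 2 z) scalerA.
  by rewrite div1r mulVf ?scale1r// pnatr_eq0.
exists [:: z + s *: x; z]; split.
  by move=> v; rewrite !inE => /orP[] /eqP ->.
have xE : x = s^-1 *: ((z + s *: x) - z).
  by rewrite addrAC subrr add0r scalerA mulVf ?scale1r// gt_eqF.
rewrite [X in X \in _]xE.
by apply: memvZ; apply: memvB; apply: memv_span; rewrite !inE eqxx ?orbT.
Qed.

End Span.

Theorem proposition3p7 (R : realType) (n d : nat) (p : mpoly n R)
    (e : 'rV[R]_n) (F : set 'rV[R]_n) (z : 'rV[R]_n)
    (hp : hyperbolic d p e)
    (hF : face (hyp_cone p e) F)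
    (hz : rel_interior F z)
    (hm : (0 < mult p e z)%N)
    (hmd : (mult p e z < d)%N \/ linear_form_power d p) :
  let m := mult p e z in
  let q := ddirn m.-1 e p in
  lin_span F = [set x | tangent q z x /\ x *m tangent_hess q z = 0].
Proof.
move=> m q; have [_ _ Fp _] := hF; have [Fz _] := hz.
have zp : hyp_cone p e z := Fp _ Fz.
apply/seteqP; split=> [x [s [sF xs]]|x Kx].
  apply: (tangent_kernel_span _ xs) => v vs.
  by apply: (face_subset_kernel hp zp hm Fp hz); exact: sF.
have {}Kx : tangent_kernel q z x := Kx.
apply: (span_of_vanish hp zp hm hF Fz); case: hmd => [md|pw].
  exact: (vanish_of_kernel hp zp hm md Kx).
exact: (vanish_of_tangent_power hp zp hm pw (proj1 Kx)).
Qed.
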